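(* Let $\Phi=(G,\varphi)$ be a finite complex unit gain graph of order $n$ (without loops and multiple edges). Then $r(\Phi)=r(G)+2\theta(G)$ if and only if all of the following hold: (i) the cycles (if any) of $G$ are pairwise vertex-disjoint; (ii) each cycle $C_p^{\varphi}$ of $\Phi$ is of Type B and has order $p\equiv 0 \pmod 4$; (iii) a series of $\delta$-transformations can transform $G$ into a crucial subgraph $G_0$ that is the disjoint union of $\theta(G)$ cycles together with some isolated vertices.
   Context: A complex unit gain graph $\Phi=(G,\varphi)$ consists of a finite simple graph $G$ (the underlying graph) with vertex set $\{v_1,\dots,v_n\}$ and a gain function $\varphi$ assigning to each oriented edge $e_{ij}$ (from $v_i$ to $v_j$, where $v_iv_j\in E(G)$) a complex number of modulus $1$, with $\varphi(e_{ji})=\overline{\varphi(e_{ij})}$. The adjacency matrix $A(\Phi)$ is the Hermitian matrix with $(i,j)$ entry $\varphi(e_{ij})$ if $v_iv_j\in E(G)$ and $0$ otherwise; $r(\Phi)$ is its rank, and $r(G)$ is the rank of the $0$-$1$ adjacency matrix of $G$. $\theta(G)=|E(G)|-|V(G)|+\omega(G)$, where $\omega(G)$ is the number of connected components. Subgraphs of $\Phi$ carry the gains of $\Phi$; a cycle $C_p^\varphi$ of $\Phi$ is a cycle of $G$ with its gains. For a gain cycle $C_p^{\varphi}$ with vertices $v_1,\dots,v_p$ in cyclic order, $\varphi(C_p)=\varphi(e_{12})\varphi(e_{23})\cdots\varphi(e_{p1})$; for $p$ even it is of Type B if $\varphi(C_p)\neq(-1)^{p/2}$. A $\delta$-transformation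 of a graph with a pendant vertex (vertex of degree $1$) deletes a pendant vertex together with its unique neighbour. A crucial subgraph of $G$ is a graph without pendant vertices obtained from $G$ by a series of $\delta$-transformations. *)

(* Defs.v *)
From HB Require Import structures.
From mathcomp Require Import all_boot all_order all_algebra.
From mathcomp Require Import complex.
From mathcomp Require Import reals.
Set Implicit Arguments. Unset Strict Implicit. Unset Printing Implicit Defensive.
Import Order.TTheory GRing.Theory Num.Theory.
Local Open Scope ring_scope.

Definition simple_graph (n : nat) (e : rel 'I_n) : Prop :=
  irreflexive e /\ symmetric e.

Definition unit_gain (R : realType) (n : nat) (e : rel 'I_n)
  (phi : 'I_n -> 'I_n -> R[i]) : Prop :=
  forall i j, e i j -> `|phi i j| = 1 /\ phi j i = (phi i j)^*.

Definition gain_adj (R : realType) (n : nat) (e : rel 'I_n)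
  (phi : 'I_n -> 'I_n -> R[i]) : 'M[R[i]]_n :=
  \matrix_(i, j) (if e i j then phi i j else 0).

Definition adj01 (R : realType) (n : nat) (e : rel 'I_n) : 'M[R]_n :=
  \matrix_(i, j) (if e i j then 1 else 0).

Definition nedges (n : nat) (e : rel 'I_n) : nat :=
  #|[set p : 'I_n * 'I_n | e p.1 p.2 && (p.1 < p.2)%N]|.

Definition ncomp (n : nat) (e : rel 'I_n) : nat :=
  n_comp (connect e) [pred _ : 'I_n | true].

(* theta(G) = |E| - |V| + omega  (always >= 0, so nat subtraction is exact) *)
Definition theta (n : nat) (e : rel 'I_n) : nat :=
  (nedges e + ncomp e - n)%N.

Definition is_cycle (n : nat) (e : rel 'I_n) (s : seq 'I_n) : bool :=
  [&& uniq s, (2 < size s)%N & cycle e s].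

Definition cyc_adj (n : nat) (s : seq 'I_n) (x y : 'I_n) : bool :=
  (x \in s) && (y \in s) && ((y == next s x) || (x == next s y)).

Definition cycle_gain (R : realType) (n : nat) (phi : 'I_n -> 'I_n -> R[i])
  (s : seq 'I_n) : R[i] :=
  \prod_(x <- s) phi x (next s x).

Definition typeB (R : realType) (n : nat) (phi : 'I_n -> 'I_n -> R[i])
  (s : seq 'I_n) : Prop :=
  ~~ odd (size s) /\ cycle_gain phi s <> (-1) ^+ (size s)./2.

Definition deg_in (n : nat) (e : rel 'I_n) (S : {set 'I_n}) (x : 'I_n) : nat :=
  #|[set y in S | e x y]|.

(* one delta-transformation on the induced subgraph G[S]: delete a pendant
   vertex u together with its unique neighbour v *)
Definition delta_step (n : nat) (e : rel 'I_n) (S S' : {set 'I_n}) : Prop :=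
  exists u v, [/\ u \in S, v \in S, e u v, deg_in e S u = 1%N &
                  S' = S :\ u :\ v].

Inductive delta_star (n : nat) (e : rel 'I_n) : {set 'I_n} -> {set 'I_n} -> Prop :=
| delta_refl S : delta_star e S S
| delta_next S S' S'' : delta_step e S S' -> delta_star e S' S'' ->
    delta_star e S S''.

Definition no_pendant (n : nat) (e : rel 'I_n) (S : {set 'I_n}) : Prop :=
  forall x, x \in S -> deg_in e S x <> 1%N.

(* Main.v *)
Require Import Defs.
From HB Require Import structures.
From mathcomp Require Import all_boot all_order all_algebra.
From mathcomp Require Import complex.
From mathcomp Require Import reals.
From mathcomp Require Import boolp zify ring.
Set Implicit Arguments. Unset Strict Implicit. Unset Printing Implicit Defensive.
Import Order.TTheory GRing.Theory Num.Theory.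
Local Open Scope ring_scope.

(* Write r1, r0 for the ranks of Phi and G.  Deleting a vertex changes a rank by
   at most 2, deleting a pendant vertex with its neighbour lowers both ranks by
   exactly 2, and deleting a vertex of a cycle lowers theta; so r1 <= r0 + 2 theta
   by induction, forests giving r1 = r0.  In the case of equality ("optimal"
   graphs) every deletion of a cycle vertex x must lower theta by exactly 1
   (whence (i)), leave r0 unchanged and lower r1 by 2; and every
   delta-transformation keeps theta and optimality.  Isolating one cycle by such
   deletions and solving the kernel recursion around it gives (ii).

   For (iii), take an optimal graph without pendant vertices and a bridge xy with
   x on a cycle.  By (ii) the graph is bipartite.  Since deleting x keeps r0, some
   null vector of G is nonzero at x; cut down to the colour class and to the side
   of x, it shows that deleting y lowers r0 by 2.  Hence the graph minus y is
   optimal, r1 drops by 2, and there is a null vector u of Phi minus y, supported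
   on one colour class, that is nonzero at a neighbour of y.  In the graph of the
   edges meeting supp u every vertex but y has degree 0 or at least 2, so supp u
   meets a cycle; but u vanishes on cycles, because deleting a cycle vertex
   lowers r1 by 2. *)

(** * Bridges, cycles and the cyclomatic number *)

Section Graph.
Local Open Scope nat_scope.
Variable n : nat.
Implicit Types (e f : rel 'I_n) (x y u v : 'I_n) (s t : seq 'I_n).

(** The vertex stays behind as an isolated one, so the vertex type and the matrix size are kept; an
    isolated vertex changes neither a rank nor [theta]. *)
Definition delv e x : rel 'I_n := fun a b => [&& e a b, a != x & b != x].

Definition dele e x y : rel 'I_n :=
  fun a b => [&& e a b, (a, b) != (x, y) & (a, b) != (y, x)].

Definition restr e (A : {set 'I_n}) : rel 'I_n :=
  fun a b => [&& e a b, a \in A & b \in A].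

(** By [is_cycle_nonbridge] and [nonbridge_cycle] these are exactly the edges on cycles;
    connectivity is the form that component counts can use. *)
Definition nonbridge e x y := e x y && connect (dele e x y) x y.

Lemma rel_ext e f : e =2 f -> e = f.
Proof. by move=> ef; apply: funext => a; apply: funext => b. Qed.

Lemma simple_sym e : simple_graph e -> symmetric e.
Proof. by case. Qed.

Lemma simple_delv e x : simple_graph e -> simple_graph (delv e x).
Proof.
case=> ei es; split=> [a|a b]; rewrite /delv ?ei //.
by rewrite es andbCA andbC -andbA andbC andbAC -!andbA; case: (e b a); rewrite // andbC.
Qed.

Lemma simple_dele e x y : simple_graph e -> simple_graph (dele e x y).
Proof.
case=> ei es; split=> [a|a b]; rewrite /dele ?ei // es !xpair_eqE.
by case: (e b a) => //=; case: (a == x); case: (a == y); case: (b == x); case: (b == y).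
Qed.

Lemma simple_restr e A : simple_graph e -> simple_graph (restr e A).
Proof.
case=> ei es; split=> [a|a b]; rewrite /restr ?ei // es.
by case: (e b a) => //=; rewrite andbC.
Qed.

Lemma sub_delv e x : subrel (delv e x) e.
Proof. by move=> a b /and3P[]. Qed.

Lemma sub_dele e x y : subrel (dele e x y) e.
Proof. by move=> a b /and3P[]. Qed.

Lemma sub_restr e A : subrel (restr e A) e.
Proof. by move=> a b /and3P[]. Qed.

Lemma deleC e x y : dele e x y = dele e y x.
Proof. by apply: rel_ext => a b; rewrite /dele; case: (e a b) => //=; rewrite andbC. Qed.

Lemma connect_subrel e f : subrel e f -> subrel (connect e) (connect f).
Proof. by move=> ef; apply: connect_sub => a b /ef; apply: connect1. Qed.

Lemma connectC e x y : simple_graph e -> connect e x y = connect e y x.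
Proof. by case=> _ es; apply: sym_connect_sym. Qed.

Lemma nonbridge_sym e x y : simple_graph e -> nonbridge e x y -> nonbridge e y x.
Proof.
move=> se /andP[exy c]; rewrite /nonbridge (simple_sym se) exy deleC.
by rewrite connectC //; apply: simple_dele.
Qed.

Lemma sub_nonbridge e f x y : subrel e f -> nonbridge e x y -> nonbridge f x y.
Proof.
move=> ef /andP[exy c]; rewrite /nonbridge ef //=.
apply: connect_subrel c => a b /and3P[eab h1 h2].
by rewrite /dele ef // h1.
Qed.

(** * Edges, components and [theta] under deletion *)

Lemma nedges_dele e x y : simple_graph e -> e x y ->
  nedges e = (nedges (dele e x y)).+1.
Proof.
move=> se; wlog xy : x y / (x < y)%N.
  move=> H exy; case: (ltngtP x y) => [||/ord_inj E].
  - by move/H; apply.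
  - by move=> yx; rewrite deleC; apply: H; rewrite // (simple_sym se).
  - by case: se => ei _; move: exy; rewrite E ei.
move=> exy; rewrite /nedges (cardsD1 (x, y)) !inE /= exy xy add1n; congr _.+1.
apply: eq_card => -[a b]; rewrite !inE /= /dele.
case: (e a b); rewrite ?andbF //=; case ab: (a < b)%N; rewrite ?andbF //= !andbT.
case: eqP => //= _; symmetry; apply/negP => /eqP [aE bE].
by move: ab; rewrite aE bE; lia.
Qed.

Lemma nedges_sub e f : subrel e f -> (nedges e <= nedges f)%N.
Proof.
move=> ef; apply/subset_leq_card/subsetP => -[a b]; rewrite !inE /=.
by case/andP => /ef ->.
Qed.

Lemma nedges_lt e f x y : simple_graph f -> subrel e f -> f x y -> ~~ e x y ->
  ~~ e y x -> (nedges e < nedges f)%N.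
Proof.
move=> sf ef fxy exy eyx; rewrite (nedges_dele sf fxy) ltnS; apply: nedges_sub.
move=> a b eab; rewrite /dele ef //=; apply/andP; split.
  by apply: contra exy => /eqP [<- <-].
by apply: contra eyx => /eqP [<- <-].
Qed.

Lemma ncompE e : ncomp e = #|[pred x | fingraph.root e x == x]|.
Proof.
rewrite /ncomp (@eq_n_comp _ _ e); last first.
  by move=> a b; apply/idP/idP => [/connect_sub|]; [apply|apply: connect1].
by apply: eq_card => a; rewrite !inE /= andbT.
Qed.

Lemma ncomp_dele_connect e x y : simple_graph e ->
  connect (dele e x y) x y -> ncomp (dele e x y) = ncomp e.
Proof.
move=> se c; have sd := simple_dele x y se.
rewrite /ncomp; apply: eq_n_comp => a b.
have H f : connect (connect f) a b = connect f a b.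
  by apply/idP/idP => [/connect_sub|]; [apply|apply: connect1].
rewrite !H; apply/idP/idP; first exact/connect_subrel/sub_dele.
apply: connect_sub => a' b' eab.
have [/eqP[-> ->]//|h1] := boolP ((a', b') == (x, y)).
have [/eqP[-> ->]|h2] := boolP ((a', b') == (y, x)); first by rewrite connectC.
by apply: connect1; rewrite /dele eab h1.
Qed.

(** Induction along the path: each crossing of the deleted edge restarts the second segment, and a
    crossing that ends where the first segment ended cancels it. *)
Lemma connect_dele_cases e x y a b : simple_graph e -> connect e a b ->
  [\/ connect (dele e x y) a b,
      connect (dele e x y) a x /\ connect (dele e x y) y b |
      connect (dele e x y) a y /\ connect (dele e x y) x b].
Proof.
move=> se /connectP[p + ->] {b}; have sd := simple_dele x y se.
elim/last_ind: p => [|p b IH]; first by constructor 1.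
rewrite rcons_path last_rcons => /andP[/IH {}IH eb].
set l := last a p in IH eb *.
have [/eqP[lx ->]|h1] := boolP ((l, b) == (x, y)).
  case: IH; rewrite ?lx.
  - by constructor 2.
  - by case; constructor 2.
  - by case; constructor 1.
have [/eqP[lx ->]|h2] := boolP ((l, b) == (y, x)).
  case: IH; rewrite ?lx.
  - by constructor 3.
  - by case; constructor 1.
  - by case; constructor 3.
have lb : connect (dele e x y) l b by apply: connect1; rewrite /dele eb h1.
case: IH => [c|[c d]|[c d]]; [constructor 1|constructor 2|constructor 3].
- exact: connect_trans c lb.
- by split=> //; apply: connect_trans d lb.
- by split=> //; apply: connect_trans d lb.
Qed.

(** Apart from the component of [y], the components of the smaller graph map injectively to those of
    [e]: two that merge do so through the edge [xy], so one of them contains [y]. *)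
Lemma ncomp_dele e x y : simple_graph e ->
  (ncomp (dele e x y) <= (ncomp e).+1)%N.
Proof.
move=> se; have sd := simple_dele x y se; rewrite !ncompE.
set d := dele e x y in sd *.
have cs : connect_sym d by move=> a b; apply: connectC.
have ces : connect_sym e by move=> a b; apply: connectC.
set A := [pred a | _]; rewrite (cardD1 (fingraph.root d y) A).
apply: (@leq_trans (1 + #|[predD1 A & fingraph.root d y]|)%N).
  by rewrite leq_add2r; case: (_ \in _).
rewrite add1n ltnS -(@card_in_imset _ _ (fingraph.root e) (mem [predD1 A & fingraph.root d y])).
  apply: subset_leq_card; apply/subsetP => a /imsetP[b _ ->].
  by rewrite inE root_root.
move=> a b; rewrite !inE => /andP[ay /eqP ra] /andP[bY /eqP rb] /eqP.
rewrite root_connect // => /(connect_dele_cases x y se).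
have K c z : connect d c z -> fingraph.root d c = fingraph.root d z.
  by move=> h; apply/(fingraph.rootP cs).
case=> [/K|[_ /K]|[/K]]; rewrite ?ra ?rb //.
  by move=> E; rewrite -E eqxx in bY.
by move=> E; rewrite E eqxx in ay.
Qed.

Lemma nedges_gt0 e : simple_graph e -> (0 < nedges e)%N -> exists x y, e x y.
Proof. by move=> se /card_gt0P[[x y]]; rewrite inE => /andP[exy _]; exists x, y. Qed.

(** This makes the truncated subtraction in [theta] exact. *)
Lemma nedges_ncomp e : simple_graph e -> (n <= nedges e + ncomp e)%N.
Proof.
move: {2}(nedges e) (leqnn (nedges e)) => k; elim: k e => [|k IH] e.
  rewrite leqn0 => /eqP E0 se; rewrite E0 ncompE.
  have ne x y : e x y = false.
    by apply/negP => exy; move: E0; rewrite (nedges_dele se exy).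
  have cc x y : connect e x y -> x = y.
    by case/connectP=> [[|z p]] /=; rewrite ?ne.
  rewrite -[X in (X <= _)%N](card_ord n) add0n; apply: subset_leq_card; apply/subsetP=> a _.
  by rewrite inE; apply/eqP; rewrite [RHS](cc _ _ (connect_root e a)).
move=> Ek se; have [E0|/(nedges_gt0 se)[x [y exy]]] := posnP (nedges e).
  by apply: IH; rewrite // E0.
have := IH _ _ (simple_dele x y se); move: Ek; rewrite (nedges_dele se exy) ltnS.
by move=> h /(_ h); have := ncomp_dele x y se; lia.
Qed.

Lemma theta_dele e x y : simple_graph e -> (theta (dele e x y) <= theta e)%N.
Proof.
move=> se; have [exy|nexy] := boolP (e x y).
  by rewrite /theta (nedges_dele se exy); have := ncomp_dele x y se; lia.
suff -> : dele e x y = e by [].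
apply: rel_ext => a b; rewrite /dele; case eab: (e a b) => //=.
apply/andP; split; apply: contraNN nexy => /eqP[<- <-] //.
by rewrite (simple_sym se).
Qed.

Lemma theta_dele_nonbridge e x y : simple_graph e -> nonbridge e x y ->
  theta e = (theta (dele e x y)).+1.
Proof.
move=> se /andP[exy c]; have := nedges_ncomp (simple_dele x y se).
by rewrite /theta (nedges_dele se exy) (ncomp_dele_connect se c); lia.
Qed.

Lemma theta_sub e f : simple_graph e -> simple_graph f -> subrel e f ->
  (theta e <= theta f)%N.
Proof.
move: {2}(nedges f) (leqnn (nedges f)) => k.
elim: k f => [|k IH] f Ek se sf ef.
  suff -> : e = f by [].
  apply: rel_ext => a b; apply/idP/idP => [/ef //|fab].
  by move: Ek; rewrite (nedges_dele sf fab).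
have [/existsP[x /existsP[y /andP[fxy exy]]]|] :=
  boolP [exists x, exists y, f x y && ~~ e x y].
  apply: leq_trans (theta_dele x y sf); apply: IH => //.
  - by move: Ek; rewrite (nedges_dele sf fxy).
  - exact: simple_dele.
  - move=> a b eab; rewrite /dele ef //=.
    apply/andP; split; apply: contraNN exy => /eqP[<- <-] //.
    by rewrite (simple_sym se).
rewrite negb_exists => /forallP H; suff -> : e = f by [].
apply: rel_ext => a b; apply/idP/idP => [/ef //|fab].
by move: (H a); rewrite negb_exists => /forallP /(_ b); rewrite fab /= negbK.
Qed.

Lemma delv_sub_dele e x y : subrel (delv e x) (dele e x y).
Proof.
move=> a b /and3P[eab ax bx]; rewrite /dele eab /=.
by apply/andP; split; [apply: contraNN ax => /eqP[-> _]|apply: contraNN bx => /eqP[_ ->]].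
Qed.

Lemma theta_delv e x : simple_graph e -> (theta (delv e x) <= theta e)%N.
Proof. by move=> se; apply: theta_sub (@sub_delv _ _) => //; apply: simple_delv. Qed.

Lemma theta_delv_nonbridge e x y : simple_graph e -> nonbridge e x y ->
  (theta (delv e x) < theta e)%N.
Proof.
move=> se nb; rewrite (theta_dele_nonbridge se nb) ltnS.
apply: theta_sub (@delv_sub_dele _ _ _); [exact: simple_delv|exact: simple_dele].
Qed.

(** * Cycles and the edges on them *)

Lemma is_cycle_sub e f s : subrel e f -> is_cycle e s -> is_cycle f s.
Proof. by move=> ef /and3P[us ss cs]; rewrite /is_cycle us ss (sub_cycle ef). Qed.

Lemma is_cycle_next e s x : is_cycle e s -> x \in s -> e x (next s x).
Proof. by case/and3P=> _ _ cs xs; apply: next_cycle. Qed.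

Lemma is_cycle_delv e s x : is_cycle e s -> x \notin s -> is_cycle (delv e x) s.
Proof.
case/and3P=> us ss cs xs; rewrite /is_cycle us ss /=.
apply: cycle_from_next => // a aS; rewrite /delv next_cycle //=.
by apply/andP; split; apply: contraNN xs => /eqP <-; rewrite ?mem_next.
Qed.

Lemma is_cycle_delv_notin e s x : is_cycle (delv e x) s -> x \notin s.
Proof.
by move=> cs; apply/negP => /(is_cycle_next cs) /and3P[_]; rewrite eqxx.
Qed.

Lemma cyc_adj_edge e s x y : simple_graph e -> is_cycle e s -> cyc_adj s x y -> e x y.
Proof.
move=> se cs /andP[/andP[xs ys]] /orP[] /eqP E; first by rewrite E is_cycle_next.
by rewrite (simple_sym se) E is_cycle_next.
Qed.

Lemma cyc_adjC s x y : cyc_adj s x y = cyc_adj s y x.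
Proof. by rewrite /cyc_adj orbC [(x \in s) && _]andbC. Qed.

Lemma cyc_adj_next s x : x \in s -> cyc_adj s x (next s x).
Proof. by move=> xs; rewrite /cyc_adj xs mem_next xs eqxx. Qed.

Lemma is_cycle_dele e s x y : is_cycle e s -> ~~ cyc_adj s x y ->
  is_cycle (dele e x y) s.
Proof.
case/and3P=> us ss cs xys; rewrite /is_cycle us ss /=.
apply: cycle_from_next => // a aS; rewrite /dele next_cycle //=.
apply/andP; split; apply: contraNN xys => /eqP[<- <-]; last rewrite cyc_adjC;
  exact: cyc_adj_next.
Qed.

Lemma is_cycle_nonbridge e s x y : simple_graph e -> is_cycle e s -> cyc_adj s x y ->
  nonbridge e x y.
Proof.
move=> se cs; wlog yx : x y / y = next s x.
  move=> H /[dup] xy /andP[/andP[xs ys]] /orP[] /eqP E; first exact: H.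
  by apply: nonbridge_sym => //; apply: H => //; rewrite cyc_adjC.
move=> /[dup] xy /andP[/andP[xs _] _]; rewrite /nonbridge (cyc_adj_edge se cs xy) /=.
case/and3P: (cs) => us ss cys.
(* Rotated to start at [x], the cycle has [y] second; the remaining path from [y] meets [x] only at
   its closing edge, which is not [xy]. *)
have [i p Ep] := rot_to xs.
have up : uniq (x :: p) by rewrite -Ep rot_uniq.
have sp : (2 < size (x :: p))%N by rewrite -Ep size_rot.
have cp : cycle e (x :: p) by rewrite -Ep rot_cycle.
have {yx} : y = next (x :: p) x by rewrite -Ep next_rot.
case: p up sp cp {Ep} => [|z [|z' p]] //= up _ cp.
rewrite eqxx => zE; subst z; rewrite connectC; last exact: simple_dele.
case/and3P: up; rewrite !inE !negb_or => /and3P[xny xnz xnp] /andP[ynz ynp] _.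
case/and3P: cp => _ eyz; rewrite rcons_path => /andP[pz el].
have lin := mem_last z' p.
have lny : last z' p != y by apply: contraTneq lin => ->; rewrite inE negb_or ynz.
apply: (@connect_trans _ _ (last z' p)); last first.
  by apply: connect1; rewrite /dele el !xpair_eqE (negbTE lny) (negbTE xny) andbF.
apply/connectP; exists (z' :: p) => //.
apply: (@sub_in_path _ (predC1 x) e) => [a b||]; last by rewrite /= eyz.
  rewrite !inE => ax bx eab; rewrite /dele eab !xpair_eqE.
  by rewrite (negbTE ax) (negbTE bx) andbF.
rewrite /= !(eq_sym _ x) xny xnz /=; apply/allP => a ap /=.
by apply: contraNneq xnp => <-.
Qed.

Lemma nonbridge_cycle e x y : simple_graph e -> nonbridge e x y ->
  exists2 s, is_cycle e s & cyc_adj s x y.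
Proof.
move=> se /andP[exy /connectP[p0 pp yE]].
case/shortenP: pp yE => p pp up _ yE.
have yp : y \in p.
  rewrite yE; case: p {pp up} yE => [/= E|z p _]; last exact: (mem_last z p).
  by move: exy; case: se => ei _; rewrite E ei.
exists (x :: p).
  rewrite /is_cycle up /= rcons_path (sub_path (@sub_dele e x y)) //=.
  rewrite -yE (simple_sym se) exy andbT.
  (* An empty path would make [xy] a loop, and a path of one edge would be the deleted edge. *)
  case: p pp yE {up yp} => [|z [|z' p]] //=.
  - by move=> _ E; move: exy; case: se => ei _; rewrite E ei.
  - by move=> + E; rewrite E /dele eqxx !andbF.
have xy : x != y by apply: contraTneq exy => ->; case: se => ei _; rewrite ei.
suff -> : cyc_adj (x :: p) x y = true by [].
rewrite /cyc_adj (next_nth _ y) !inE eqxx yp orbT !andTb /= (negbTE xy).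
apply/orP; right; case/andP: up => xp upp.
(* As [y] comes last, its index in [x :: p] is one past the end of [p], where [nth] returns its
   default [x]: the wrap-around of [next]. *)
have iy : (index y p).+1 = size p.
  case: p {pp yp xp} yE upp => [E|z p -> upp]; first by rewrite E eqxx in xy.
  by rewrite [last _ _]/(last z p) index_last.
by rewrite iy nth_default.
Qed.

(** Deleting [x] removes the edge [xy] of [s] and then an edge of [t] at [x], which still lies on
    the cycle [t] because [t] avoids [xy]; each costs one. *)
Lemma theta_delv_two_cycles e s t x y : simple_graph e -> is_cycle e s -> is_cycle e t ->
  x \in t -> cyc_adj s x y -> ~~ cyc_adj t x y -> ((theta (delv e x)).+2 <= theta e)%N.
Proof.
move=> se cs ct xt sxy txy; have sd := simple_dele x y se.
rewrite (theta_dele_nonbridge se (is_cycle_nonbridge se cs sxy)) ltnS.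
have := is_cycle_nonbridge sd (is_cycle_dele ct txy) (cyc_adj_next xt).
move/(theta_delv_nonbridge sd); apply: leq_trans; rewrite ltnS.
apply: theta_sub; do ?[exact: simple_delv | exact: (simple_delv _ sd)].
move=> a b /[dup] /(@delv_sub_dele _ _ y) h /and3P[_ ax bx].
by rewrite /delv h ax.
Qed.

Lemma next_closed e s (P : pred 'I_n) x : is_cycle e s -> x \in s -> P x ->
  (forall a, a \in s -> P a -> P (next s a)) -> forall a, a \in s -> P a.
Proof.
case/and3P=> us _ _ xs Px H a.
rewrite -(fconnect_cycle (cycle_next us) xs) => /connectP[p + ->].
elim/last_ind: p => //= p b IH; rewrite rcons_path last_rcons => /andP[/[dup] pp /IH {}IH /eqP <-].
apply: H => //; rewrite -(fconnect_cycle (cycle_next us) xs).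
by apply/connectP; exists p.
Qed.

(** Degree 0 or at least 2 outside [B], phrased so that a walk arriving at [v] from [w] can go
    on. *)
Definition no_dead_end e (B : {set 'I_n}) :=
  forall v w, v \notin B -> e v w -> exists2 w', e v w' & w' != w.

Definition connected_set e (L : {set 'I_n}) :=
  forall a b, a \in L -> b \in L -> connect (restr e L) a b.

Lemma connected_set1 e x : connected_set e [set x].
Proof. by move=> a b /set1P -> /set1P ->. Qed.

(* The connected set [L] is enlarged by [v] until a new edge leads back to it;
   that edge is then not a bridge. *)
Lemma no_dead_end_nonbridge e B (L : {set 'I_n}) w v : simple_graph e ->
  no_dead_end e B -> B \subset L -> connected_set e L ->
  w \in L -> v \notin L -> e w v -> exists x y, x \notin B /\ nonbridge e x y.
Proof.
move=> se nde; move: {2}#|~: L| (leqnn #|~: L|) => k.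
elim: k L w v => [|k IH] L w v Lk BL cL wL vL ewv.
  by move: Lk; rewrite leqn0 cards_eq0 => /eqP/setP/(_ v); rewrite !inE vL.
have vB : v \notin B by apply: contra vL; apply: subsetP.
have evw : e v w by rewrite (simple_sym se).
have [w' evw' ww'] := nde _ _ vB evw.
have [w'L|w'L] := boolP (w' \in L).
  exists v, w'; split=> //; rewrite /nonbridge evw' /=.
  apply: (@connect_trans _ _ w).
    apply: connect1; rewrite /dele evw !xpair_eqE eqxx eq_sym (negbTE ww') /=.
    by apply: contraNN vL => /andP[/eqP-> _].
  apply: connect_subrel (cL _ _ wL w'L) => a b /and3P[eab aL bL].
  rewrite /dele eab !xpair_eqE /=.
  by apply/andP; split; apply: contraNN vL => /andP[/eqP ? /eqP ?]; subst.
have vw' : v != w' by apply: contraTneq evw' => ->; case: se => ei _; rewrite ei.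
apply: (IH (v |: L) v w') => //.
- rewrite -ltnS; apply: leq_trans Lk; apply: proper_card.
  apply/properP; split; first by rewrite setCS subsetUr.
  by exists v; rewrite !inE ?eqxx.
- by apply: subset_trans BL (subsetUr _ _).
- have sR : simple_graph (restr e (v |: L)) by exact: simple_restr.
  have H a : a \in v |: L -> connect (restr e (v |: L)) w a.
    case/setU1P => [->|aL]; first by apply: connect1; rewrite /restr ewv !inE wL eqxx orbT.
    apply: connect_subrel (cL _ _ wL aL) => a' b' /and3P[h h1 h2].
    by rewrite /restr h !inE h1 h2 !orbT.
  move=> a b /H ha /H hb; apply: connect_trans hb.
  by rewrite connectC.
- by rewrite !inE eqxx.
- by rewrite !inE negb_or eq_sym vw'.
Qed.

(* A shortest odd closed walk is a cycle. *)
Lemma odd_closed_walk e s : simple_graph e ->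
  (forall t, is_cycle e t -> ~~ odd (size t)) -> cycle e s -> ~~ odd (size s).
Proof.
move=> se H; move: {2}(size s) (leqnn (size s)) => k; elim: k s => [|k IH] s.
  by rewrite leqn0 => /eqP ->.
move=> sk cs; have [us|] := boolP (uniq s).
  case: s us sk cs => [|a [|b [|c s]]] // us sk cs.
    by move: cs => /=; case: se => ei _; rewrite ei.
  by apply: H; rewrite /is_cycle us cs.
move=> nus.
(* A repeated vertex splits the closed walk into two shorter closed walks whose lengths add up to
   its own. *)
have [x [p0 [p1 [p2 E]]]] : exists x p0 p1 p2, s = p0 ++ x :: p1 ++ x :: p2.
  elim: s nus {sk cs IH} => //= a s IH; rewrite negb_and negbK.
  have [/splitPr[p1 p2] _|_ /IH[x [p0 [p1 [p2 ->]]]]] := boolP (a \in s).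
    by exists a, [::], p1, p2.
  by exists x, (a :: p0), p1, p2.
move: cs; rewrite -(rot_cycle (size p0)) E rot_size_cat /=.
rewrite -!catA /= !rcons_cat /= cat_path /= rcons_cat => /and3P[c1 c2 c3].
have c4 : cycle e (x :: p1) by rewrite /= rcons_path c1.
have c5 : cycle e (x :: p2 ++ p0) by rewrite /= rcons_cat.
have := IH _ _ c4; have := IH _ _ c5; move: sk; rewrite E !(size_cat, size_rcons) /=.
by rewrite !(size_cat, size_rcons) /=; lia.
Qed.

(** The colour is the parity of a chosen path from the root of the component. For an edge with equal
    colours, the two paths and the edge would form an odd closed walk. *)
Lemma two_colouring e : simple_graph e ->
  (forall t, is_cycle e t -> ~~ odd (size t)) ->
  exists col : 'I_n -> bool, forall x y, e x y -> col x != col y.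
Proof.
move=> se H; have es := simple_sym se.
have cs : connect_sym e by apply: sym_connect_sym.
have P x : exists p, path e (fingraph.root e x) p && (x == last (fingraph.root e x) p).
  have : connect e (fingraph.root e x) x by rewrite cs connect_root.
  by case/connectP=> p pp E; exists p; rewrite pp -E eqxx.
exists (fun x => odd (size (xchoose (P x)))) => x y exy.
have /andP[] := xchooseP (P x); have /andP[] := xchooseP (P y).
move: (xchoose _) (xchoose _) => p q.
have -> : fingraph.root e y = fingraph.root e x.
  by apply/esym/(fingraph.rootP cs)/connect1.
move: (fingraph.root e x) => r pq /eqP yE pp /eqP xE.
pose w := rcons p y ++ rev (belast r q).
have pw : path e r w.
  rewrite cat_path rcons_path pp -xE exy last_rcons /= {1}yE rev_path.
  by rewrite (eq_path (e' := e)) // => a b; rewrite es.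
have lw : last r w = r.
  by rewrite last_cat last_rcons yE; case: (q) => //= a q'; rewrite rev_cons last_rcons.
have : ~~ odd (size w).
  case/lastP: w pw lw => [//|w a] + E; rewrite last_rcons in E; subst a => pw.
  by rewrite size_rcons; apply: (odd_closed_walk (s := r :: w) se H).
rewrite size_cat size_rcons size_rev size_belast addSn /= negbK oddD.
by case: (odd _); case: (odd _).
Qed.

End Graph.

(** * Rank under vertex deletion *)

Section VertexDeletionRank.
Variables (F : fieldType) (n : nat).
Implicit Types (A : 'M[F]_n) (z : 'rV[F]_n) (x : 'I_n).

(** Multiplication on the left clears row [x], on the right column [x]; doing both is deletion of
    the vertex, see [wadj_delv]. *)
Definition kill x : 'M[F]_n := diag_mx (\row_i (i != x)%:R).

Lemma mul_kill m (B : 'M[F]_(m, n)) x i j : (B *m kill x) i j = B i j * (j != x)%:R.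
Proof. by rewrite mul_mx_diag !mxE. Qed.

Lemma kill_mul m (B : 'M[F]_(n, m)) x i j : (kill x *m B) i j = (i != x)%:R * B i j.
Proof. by rewrite mul_diag_mx !mxE. Qed.

Lemma kill_tr x : (kill x)^T = kill x.
Proof. exact: tr_diag_mx. Qed.

Lemma killE m (B : 'M[F]_(n, m)) x : kill x *m B = B - delta_mx x x *m B.
Proof.
apply/matrixP=> k j; rewrite kill_mul !mxE (bigD1 x) //= mxE eqxx andbT.
rewrite big1 => [|l lx]; last by rewrite mxE (negbTE lx) andbF mul0r.
by have [->|_] := eqVneq k x; rewrite ?(mul0r, mul1r, addr0, subrr, subr0).
Qed.

Lemma rank_kill_ge m (B : 'M[F]_(n, m)) x : (\rank B <= (\rank (kill x *m B)).+1)%N.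
Proof.
have {1}-> : B = kill x *m B + delta_mx x x *m B by rewrite killE subrK.
apply: leq_trans (mxrank_add _ _) _; rewrite -addn1 leq_add2l.
by apply: leq_trans (mxrankM_maxl _ _) _; rewrite mxrank_delta.
Qed.

Lemma rank_mul_kill_ge m (B : 'M[F]_(m, n)) x : (\rank B <= (\rank (B *m kill x)).+1)%N.
Proof.
rewrite -mxrank_tr (leq_trans (rank_kill_ge _ x)) //.
by rewrite -mxrank_tr trmx_mul trmxK kill_tr.
Qed.

(** The null vector expresses row [x] through the other rows. *)
Lemma rank_kill_dep m (B : 'M[F]_(n, m)) x z : z *m B = 0 -> z 0 x != 0 ->
  \rank (kill x *m B) = \rank B.
Proof.
move=> zB zx; apply/eqP; rewrite eqn_leq mxrankM_maxr /=; apply: mxrankS.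
apply/row_subP=> i; have [->|ix] := eqVneq i x; last first.
  have -> : row i B = row i (kill x *m B).
    by apply/rowP=> j; rewrite mxE [RHS]mxE kill_mul ix mul1r.
  exact: row_sub.
have -> : row x B = (- (z 0 x)^-1 *: z) *m (kill x *m B).
  rewrite killE mulmxBr -!scalemxAl zB scaler0 sub0r scaleNr opprK mulmxA.
  have -> : z *m delta_mx x x = z 0 x *: delta_mx 0 x.
    apply/rowP=> j; rewrite !mxE (bigD1 x) //= big1 => [|k kx]; last first.
      by rewrite mxE (negbTE kx) mulr0.
    by rewrite mxE eqxx addr0.
  by rewrite -scalemxAl scalerA mulVf // scale1r -rowE.
exact: submxMl.
Qed.

Lemma rank_kill_eq_null m (B : 'M[F]_(n, m)) x : \rank (kill x *m B) = \rank B ->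
  exists2 z : 'rV[F]_n, z *m B = 0 & z 0 x != 0.
Proof.
move=> rE; have : (B <= kill x *m B)%MS.
  by rewrite -(geq_leqif (mxrank_leqif_sup (submxMl _ _))) rE.
move/(submx_trans (row_sub x B))/submxP=> [k kE].
exists (delta_mx 0 x - k *m kill x).
  by rewrite mulmxBl -rowE kE mulmxA subrr.
by rewrite mxE [X in _ + X]mxE mul_kill eqxx mulr0 subr0 mxE !eqxx oner_eq0.
Qed.

(** The left kernel grows strictly, since it gains [z]. *)
Lemma rank_mul_kill_lt m (B : 'M[F]_(m, n)) (z : 'rV[F]_m) x :
  z *m B *m kill x = 0 -> z *m B != 0 -> (\rank (B *m kill x) < \rank B)%N.
Proof.
move=> z0 z1; have lt : (kermx B < kermx (B *m kill x))%MS.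
  rewrite ltmxE; apply/andP; split.
    by apply/sub_kermxP; rewrite mulmxA mulmx_ker mul0mx.
  apply: contra z1 => /(submx_trans _) H; apply/eqP/sub_kermxP/H/sub_kermxP.
  by rewrite mulmxA.
move: (rank_ltmx lt); rewrite !mxrank_ker.
by have := rank_leq_row B; lia.
Qed.

(* Left-multiplying by the kernel of the smaller matrix isolates column [x]. *)
Lemma rank_mul_kill_lt_null m (B : 'M[F]_(m, n)) x :
  (\rank (B *m kill x) < \rank B)%N ->
  exists2 z : 'rV[F]_m, z *m B *m kill x = 0 & (z *m B) 0 x != 0.
Proof.
move=> lt; have : kermx (B *m kill x) *m B != 0.
  apply: contraTneq lt => /sub_kermxP/mxrankS; rewrite !mxrank_ker -leqNgt.
  by have := rank_leq_row B; have := rank_leq_row (B *m kill x); lia.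
move/rowV0Pn => [v /submxP[k vE] v0].
have kE : k *m kermx (B *m kill x) *m B *m kill x = 0.
  by rewrite -2!mulmxA mulmx_ker mulmx0.
exists (k *m kermx (B *m kill x)) => //.
apply: contraNneq v0 => kx; apply/eqP/rowP=> j; rewrite vE mulmxA.
have [->|jx] := eqVneq j x; first by rewrite kx mxE.
by move/rowP/(_ j): kE; rewrite mul_kill jx mulr1 => ->.
Qed.

(** [z] makes row [x] redundant and [z'] column [x]; two vectors appear because [A] is a general
    matrix, not a symmetric one. *)
Lemma rank_cross_neutral A x (z z' : 'rV[F]_n) : z *m A = 0 -> z 0 x != 0 ->
  z' *m A^T = 0 -> z' 0 x != 0 -> \rank (kill x *m A *m kill x) = \rank A.
Proof.
move=> zA zx zA' zx'; rewrite -mxrank_tr trmx_mul kill_tr.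
rewrite (@rank_kill_dep _ (kill x *m A)^T _ z') ?mxrank_tr ?(rank_kill_dep zA zx) //.
by rewrite trmx_mul mulmxA zA' mul0mx.
Qed.

Lemma rank_cross_neutral_null A x : \rank (kill x *m A *m kill x) = \rank A ->
  exists2 z : 'rV[F]_n, z *m A = 0 & z 0 x != 0.
Proof.
move=> rE; apply: rank_kill_eq_null.
have := mxrankM_maxl (kill x *m A) (kill x); have := mxrankM_maxr (kill x) A.
lia.
Qed.

Lemma rank_cross_le A x : (\rank (kill x *m A *m kill x) <= \rank A)%N.
Proof. exact: leq_trans (mxrankM_maxl _ _) (mxrankM_maxr _ _). Qed.

Lemma rank_cross_ge A x : (\rank A <= (\rank (kill x *m A *m kill x)).+2)%N.
Proof.
have := rank_kill_ge A x; have := rank_mul_kill_ge (kill x *m A) x; lia.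
Qed.

(** A drop by 2 leaves no room for a free row deletion, which a null vector nonzero at [x] would
    give. *)
Lemma rank_cross_drop2_null A x z : \rank A = (\rank (kill x *m A *m kill x)).+2 ->
  z *m A = 0 -> z 0 x = 0.
Proof.
move=> rE zA; apply/eqP; apply/negPn/negP => zx.
by have := rank_kill_dep zA zx; have := rank_mul_kill_ge (kill x *m A) x; lia.
Qed.

(** The vector [z] shows that the unit vector at [x] is a combination of the rows other than row
    [x], so clearing column [x] after row [x] costs one; [z'] puts it in the column space of [A], so
    clearing row [x] costs one too. *)
Lemma rank_cross_drop2 A x z z' :
  z 0 x = 0 -> (forall j, j != x -> (z *m A) 0 j = 0) -> (z *m A) 0 x != 0 ->
  z' 0 x = 0 -> (forall j, j != x -> (z' *m A^T) 0 j = 0) -> (z' *m A^T) 0 x != 0 ->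
  \rank A = (\rank (kill x *m A *m kill x)).+2.
Proof.
have K (y : 'rV[F]_n) : y 0 x = 0 -> y *m kill x = y.
  move=> yx; apply/rowP=> j; rewrite mul_kill.
  by have [->|_] := eqVneq j x; rewrite ?yx ?mulr1 // mul0r.
have K0 (y : 'rV[F]_n) : (forall j, j != x -> y 0 j = 0) -> y *m kill x = 0.
  move=> H; apply/rowP=> j; rewrite mul_kill mxE.
  by have [->|/H->] := eqVneq j x; rewrite ?mulr0 ?mul0r.
have N0 (y : 'rV[F]_n) : y 0 x != 0 -> y != 0 by apply: contraNneq => ->; rewrite mxE.
move=> zx zA zAx zx' zA' zAx'; apply/eqP; rewrite eqn_leq rank_cross_ge /=.
apply: (@leq_ltn_trans (\rank (kill x *m A))).
  have zk : z *m (kill x *m A) = z *m A by rewrite mulmxA K.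
  by apply: (@rank_mul_kill_lt _ _ z); rewrite zk; [apply: K0|apply: N0].
rewrite -mxrank_tr -[X in (_ < X)%N]mxrank_tr trmx_mul kill_tr.
by apply: (@rank_mul_kill_lt _ _ z'); [apply: K0|apply: N0].
Qed.

Lemma rank_cross_drop2_witness A x : \rank A = (\rank (kill x *m A *m kill x)).+2 ->
  exists z : 'rV[F]_n, [/\ z 0 x = 0, forall j, j != x -> (z *m A) 0 j = 0 & (z *m A) 0 x != 0].
Proof.
move=> rE; have lt : (\rank (kill x *m A *m kill x) < \rank (kill x *m A))%N.
  by have := rank_kill_ge A x; lia.
have [z z0 zx] := rank_mul_kill_lt_null lt.
exists (z *m kill x); rewrite -mulmxA; split=> [|j jx|//]; first by rewrite mul_kill eqxx mulr0.
by move/rowP/(_ j): z0; rewrite mul_kill jx mulr1 => ->; rewrite mxE.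
Qed.

End VertexDeletionRank.

(** * Weighted adjacency matrices and pendant vertices *)

Section WeightedAdjacency.
Variables (F : fieldType) (n : nat).
Implicit Types (w : 'I_n -> 'I_n -> F) (e : rel 'I_n) (u : 'I_n -> F) (x y : 'I_n).

(** Gains and the constant weight 1 are both instances, so each rank lemma serves the gain graph and
    its underlying graph. *)
Definition wadj w e : 'M[F]_n := \matrix_(i, j) (if e i j then w i j else 0).

Definition wtr w : 'I_n -> 'I_n -> F := fun i j => w j i.

(** Coordinate [j] of the row vector [u] times [wadj w e], see [mul_wadj]; null vectors thus become
    local conditions at the vertices. *)
Definition flow w e u j := \sum_(i | e i j) u i * w i j.

Lemma wadj_delv w e x : wadj w (delv e x) = kill F x *m wadj w e *m kill F x.
Proof.
apply/matrixP=> i j; rewrite mul_kill kill_mul !mxE /delv.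
by case: (e i j); case: (i != x); case: (j != x); rewrite ?(mulr0, mul0r, mulr1, mul1r).
Qed.

Lemma wadj_tr w e : symmetric e -> (wadj w e)^T = wadj (wtr w) e.
Proof. by move=> es; apply/matrixP=> i j; rewrite !mxE es. Qed.

Lemma mul_wadj w e u j : ((\row_i u i) *m wadj w e) 0 j = flow w e u j.
Proof.
rewrite mxE /flow [RHS]big_mkcond; apply: eq_bigr => i _; rewrite !mxE.
by case: (e i j); rewrite ?mulr0.
Qed.

Lemma rowK (z : 'rV[F]_n) : z = \row_i z 0 i.
Proof. by apply/rowP=> i; rewrite mxE. Qed.

Lemma rank_delv_le w e x : (\rank (wadj w (delv e x)) <= \rank (wadj w e))%N.
Proof. by rewrite wadj_delv rank_cross_le. Qed.

Lemma rank_delv_ge w e x : (\rank (wadj w e) <= (\rank (wadj w (delv e x))).+2)%N.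
Proof. by rewrite wadj_delv rank_cross_ge. Qed.

Lemma rank_delv_neutral w e x u u' : symmetric e ->
  (forall j, flow w e u j = 0) -> u x != 0 ->
  (forall j, flow (wtr w) e u' j = 0) -> u' x != 0 ->
  \rank (wadj w (delv e x)) = \rank (wadj w e).
Proof.
move=> es f0 ux f0' ux'; rewrite wadj_delv.
apply: (@rank_cross_neutral _ _ _ _ (\row_i u i) (\row_i u' i)); rewrite ?mxE //.
  by apply/rowP=> j; rewrite mul_wadj f0 mxE.
by apply/rowP=> j; rewrite wadj_tr // mul_wadj f0' mxE.
Qed.

Lemma rank_delv_neutral_null w e x : \rank (wadj w (delv e x)) = \rank (wadj w e) ->
  exists2 u, forall j, flow w e u j = 0 & u x != 0.
Proof.
rewrite wadj_delv => /rank_cross_neutral_null[z z0 zx]; exists (z 0) => // j.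
by rewrite -mul_wadj -rowK z0 mxE.
Qed.

Lemma rank_delv_drop2 w e x u u' : symmetric e ->
  u x = 0 -> (forall j, j != x -> flow w e u j = 0) -> flow w e u x != 0 ->
  u' x = 0 -> (forall j, j != x -> flow (wtr w) e u' j = 0) ->
  flow (wtr w) e u' x != 0 ->
  \rank (wadj w e) = (\rank (wadj w (delv e x))).+2.
Proof.
move=> es ux fu fx ux' fu' fx'; rewrite wadj_delv.
apply: (@rank_cross_drop2 _ _ _ _ (\row_i u i) (\row_i u' i));
  rewrite ?wadj_tr ?mul_wadj ?mxE // => j jx; rewrite mul_wadj; auto.
Qed.

Lemma rank_delv_drop2_witness w e x :
  \rank (wadj w e) = (\rank (wadj w (delv e x))).+2 ->
  exists u, [/\ u x = 0, forall j, j != x -> flow w e u j = 0 & flow w e u x != 0].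
Proof.
rewrite wadj_delv => /rank_cross_drop2_witness[z [z0 z1 z2]]; exists (z 0).
by split=> // [j jx|]; rewrite -mul_wadj -rowK //; apply: z1.
Qed.

Lemma rank_delv_drop2_null w e x u :
  \rank (wadj w e) = (\rank (wadj w (delv e x))).+2 ->
  (forall j, flow w e u j = 0) -> u x = 0.
Proof.
rewrite wadj_delv => rE f0.
have := @rank_cross_drop2_null _ _ _ _ (\row_i u i) rE; rewrite mxE; apply.
by apply/rowP=> j; rewrite mul_wadj f0 mxE.
Qed.

Lemma flow_delv w e u x j : u x = 0 -> j != x -> flow w (delv e x) u j = flow w e u j.
Proof.
move=> ux jx; rewrite /flow big_mkcond [RHS]big_mkcond; apply: eq_bigr => i _.
rewrite /delv jx andbT; case: (e i j) => //=.
by case: eqP => [->|//]; rewrite ux mul0r.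
Qed.

Definition pendant e x y := e x y /\ forall z, e x z -> z = y.

Lemma delv_pendant e x y : simple_graph e -> pendant e x y ->
  delv (delv e x) y = delv e y.
Proof.
move=> se [exy H]; apply: rel_ext => a b; rewrite /delv.
case eab: (e a b) => //=; case: (a =P x) => [aE|_]; case: (b =P x) => [bE|_];
  rewrite ?andbT //=; subst; rewrite ?(H _ eab) ?eqxx ?andbF //.
by rewrite (H a) ?eqxx // (simple_sym se).
Qed.

Lemma rank_pendant w e x y : simple_graph e -> (forall i j, w i j != 0) ->
  pendant e x y -> \rank (wadj w e) = (\rank (wadj w (delv (delv e x) y))).+2.
Proof.
move=> se w0 px; rewrite (delv_pendant se px); case: px => exy H.
have xy : x != y by apply: contraTneq exy => ->; case: se => ei _; rewrite ei.
(* The indicator of the pendant vertex has flow only at its neighbour [y], and serves for the matrix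
   and its transpose alike. *)
pose u i : F := (i == x)%:R.
have fu w' j : flow w' e u j = if e x j then w' x j else 0.
  rewrite /flow big_mkcond (bigD1 x) //= big1 => [|i ix]; last first.
    by rewrite /u (negbTE ix) mul0r if_same.
  by rewrite /u eqxx mul1r addr0.
have fu0 w' j : j != y -> flow w' e u j = 0.
  by move=> jy; rewrite fu; case: ifP => // /H jE; rewrite jE eqxx in jy.
apply: (@rank_delv_drop2 _ _ _ u u); rewrite ?fu ?exy ?w0 //.
- exact: simple_sym.
- by rewrite /u eq_sym (negbTE xy).
- by move=> j; apply: fu0.
- by rewrite /u eq_sym (negbTE xy).
- by move=> j; apply: fu0.
Qed.

End WeightedAdjacency.

(** * Vertex deletion on a chordless cycle that forms a component *)

Section CycleComponent.
Variables (F : fieldType) (n : nat).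
Implicit Types (w : 'I_n -> 'I_n -> F) (u : 'I_n -> F).
Variables (e : rel 'I_n) (s : seq 'I_n) (x0 : 'I_n).
Hypotheses (se : simple_graph e) (cs : is_cycle e s) (x0s : x0 \in s).
Hypothesis s_closed : forall x y, x \in s -> e x y -> cyc_adj s x y.

Definition cgain w (t : seq 'I_n) := \prod_(x <- t) w x (next t x).

Let us : uniq s. Proof. by case/and3P: cs. Qed.
(** Positions along the cycle from [x0], periodic by [fp], so that the neighbours of [f i.+1] are
    always [f i] and [f i.+2]. *)
Let f i := iter i (next s) x0.
Let p := size s.

Let fs i : f i \in s.
Proof. by elim: i => [//|i IH]; rewrite /f iterS mem_next. Qed.

Let order_p : order (next s) x0 = p.
Proof. exact: (order_cycle (cycle_next us) us x0s). Qed.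

Let fp : f p = x0.
Proof. by rewrite /f -order_p iter_order //; apply: (can_inj (prev_next us)). Qed.

Let f_inj i j : (i < p)%N -> (j < p)%N -> f i = f j -> i = j.
Proof.
rewrite -order_p => ip jp E.
by rewrite -(findex_iter ip) -(findex_iter jp) /= -[iter i _ _]/(f i) E.
Qed.

Let f_surj x : x \in s -> exists2 i, (i < p)%N & x = f i.
Proof.
rewrite -(fconnect_cycle (cycle_next us) x0s) => c.
by exists (findex (next s) x0 x); rewrite -?order_p ?findex_max // /f iter_findex.
Qed.

Let p3 : (2 < p)%N. Proof. by case/and3P: cs. Qed.

Let f2_neq i : f i.+2 != f i.
Proof.
have fS a b : f (a + b) = iter a (next s) (f b) by rewrite /f iterD.
have inj : injective (next s) := can_inj (prev_next us).
have : f 2 != f 0 by apply/negP => /eqP /f_inj; lia.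
apply: contra; rewrite -(addn2 i) fS; elim: i => //= i IH /eqP/inj/eqP; exact: IH.
Qed.

Let flow_f w u i :
  flow w e u (f i.+1) = u (f i) * w (f i) (f i.+1) + u (f i.+2) * w (f i.+2) (f i.+1).
Proof.
have e1 : e (f i) (f i.+1) by apply: is_cycle_next.
have e2 : e (f i.+2) (f i.+1) by rewrite (simple_sym se); exact: (is_cycle_next cs (fs i.+1)).
rewrite /flow (bigD1 (f i)) //= (bigD1 (f i.+2)) ?e2 ?f2_neq //=.
rewrite big1 ?addr0 // => a /andP[/andP[ea a1] a2].
have : cyc_adj s (f i.+1) a by apply: s_closed; rewrite // (simple_sym se).
case/andP => _ /orP[] /eqP E; first by rewrite E eqxx in a2.
by case/negP: a1; apply/eqP/(can_inj (prev_next us)).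
Qed.

Let cgainE w : cgain w s = \prod_(0 <= i < p) w (f i) (f i.+1).
Proof.
rewrite /cgain -(big_map (fun i => f i) predT (fun x => w x (next s x))).
apply: perm_big; rewrite perm_sym.
have -> : [seq f i | i <- index_iota 0 p] = orbit (next s) x0.
  rewrite /orbit order_p /index_iota subn0; elim: p => // k IH.
  by rewrite -addn1 iotaD map_cat IH addn1 trajectSr cats1.
by rewrite (orbitE (cycle_next us) us x0s) perm_rot.
Qed.

(* The kernel recursion [u (f i.+2) = - u (f i) * w (f i) (f i.+1) * w (f i.+1) (f i.+2)]
   run along the odd positions only breaks at the starting vertex. *)
Let alternating_vector w : (forall x y, w x y * w y x = 1) -> ~~ odd p ->
  exists u, [/\ u x0 = 0, u (next s x0) != 0,
    forall j, j != x0 -> flow w e u j = 0 &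
    flow w e u x0 = 1 - (-1) ^+ p./2 * cgain w s].
Proof.
move=> wK ep; pose P k := \prod_(0 <= i < k) w (f i) (f i.+1).
have PS k : P k.+1 = P k * w (f k) (f k.+1) by rewrite /P big_nat_recr.
pose a k := if odd k then (-1) ^+ k./2 * P k else 0.
pose u x := if x \in s then a (findex (next s) x0 x) else 0.
have uf k : (k < p)%N -> u (f k) = a k.
  by move=> kp; rewrite /u fs /f findex_iter // order_p.
have u0 : u (f 0) = 0 by rewrite uf //; apply: ltn_trans p3.
have fl k : (k.+2 <= p)%N -> flow w e u (f k.+1) = 0.
  move=> kp; rewrite flow_f uf; last by lia.
  have [ok|nok] := boolP (odd k); last first.
    rewrite {1}/a (negbTE nok) mul0r add0r.
    have [k2p|kp2] := ltnP k.+2 p.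
      by rewrite uf // /a /= negbK (negbTE nok) mul0r.
    have -> : k.+2 = p by lia.
    by rewrite fp -[x0]/(f 0) u0 mul0r.
  have k2p : (k.+2 < p)%N by lia.
  rewrite uf // /a /= negbK ok !PS exprS.
  set W := w (f k.+1) (f k.+2); set W' := w (f k.+2) (f k.+1).
  have WK : W * W' = 1 by apply: wK.
  transitivity ((-1) ^+ k./2 * P k * w (f k) (f k.+1) * (1 - W * W')); first by ring.
  by rewrite WK subrr mulr0.
exists u; split => //.
- rewrite -[next s x0]/(f 1) uf ?(ltn_trans _ p3) // /a /= expr0 mul1r PS /P big_geq // mul1r.
  by apply: contra_eqN (wK (f 0) (f 1)) => /eqP ->; rewrite mul0r eq_sym oner_eq0.
- move=> j jx; have [js|js] := boolP (j \in s).
    have [[|i] ip E] := f_surj js; first by rewrite E eqxx in jx.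
    by rewrite E fl.
  rewrite /flow big1 // => i eij; rewrite /u; case: ifP => is_; last by rewrite mul0r.
  by case/andP: (s_closed is_ eij) => /andP[_]; rewrite (negbTE js).
- have -> : cgain w s = P p by rewrite cgainE.
  (* The neighbours of [x0] are [f 1], contributing 1, and [f q.+1], whose term closes the product
     of gains and carries the sign opposite to [(-1) ^+ p./2]. *)
  have [q pq] : exists q, p = q.+2 by exists p.-2; lia.
  have fq : f q.+2 = x0 by rewrite -pq fp.
  have eq : ~~ odd q by move: ep; rewrite pq /= negbK.
  rewrite -{1}fq flow_f -[f q.+3]/(next s (f q.+2)) fq -[next s x0]/(f 1).
  have q1p : (q.+1 < p)%N by rewrite pq.
  rewrite (uf _ q1p) (uf 1) ?(ltn_trans _ p3) // pq.
  have P1 : P 1 * w (next s x0) x0 = 1 by rewrite PS /P big_geq // mul1r wK.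
  have P2 : P q.+1 * w (next s (f q)) x0 = P q.+2 by rewrite [RHS]PS fq.
  rewrite /a /= eq uphalf_half (negbTE eq) add0n exprS mul1r -P2 P1; ring.
Qed.

(** Transposing the weights inverts the gain, and a sign is its own inverse. *)
Let sign_cgain_wtr w : (forall x y, w x y * w y x = 1) ->
  (cgain (wtr w) s == (-1) ^+ p./2) = (cgain w s == (-1) ^+ p./2).
Proof.
move=> wK; have gK : cgain w s * cgain (wtr w) s = 1.
  by rewrite -big_split big1 //= => x _; apply: wK.
have sK : (-1) ^+ p./2 * (-1) ^+ p./2 = 1 :> F by rewrite -expr2 sqrr_sign.
have e0 : (-1) ^+ p./2 != 0 :> F by rewrite signr_eq0.
apply/eqP/eqP => E; first by apply: (mulIf e0); rewrite -{1}E gK sK.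
by apply: (mulfI e0); rewrite -{1}E gK sK.
Qed.

(** The alternating vector vanishes at [x0] and, for this gain, has nonzero flow there and nowhere
    else, as [rank_delv_drop2] requires. *)
Lemma rank_cycle_drop2 w : (forall x y, w x y * w y x = 1) -> ~~ odd (size s) ->
  cgain w s != (-1) ^+ (size s)./2 ->
  \rank (wadj w e) = (\rank (wadj w (delv e x0))).+2.
Proof.
move=> wK ep g.
have wK' x y : wtr w x y * wtr w y x = 1 by apply: wK.
have nz w' : (forall x y, w' x y * w' y x = 1) -> cgain w' s != (-1) ^+ p./2 ->
    1 - (-1) ^+ p./2 * cgain w' s != 0.
  move=> _; apply: contra; rewrite subr_eq0 => /eqP E.
  have e0 : (-1) ^+ p./2 != 0 :> F by rewrite signr_eq0.
  by apply/eqP/(mulfI e0); rewrite -E -expr2 sqrr_sign.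
have [u [u0 _ uj ux]] := alternating_vector wK ep.
have [u' [u0' _ uj' ux']] := alternating_vector wK' ep.
apply: (@rank_delv_drop2 _ _ _ _ _ u u') => //; first exact: simple_sym.
  by rewrite ux nz.
by rewrite ux' nz // sign_cgain_wtr.
Qed.

(** With this gain the alternating vector is a null vector. It is zero at [x0] but not at the next
    vertex, hence the choice of the deleted vertex. *)
Lemma rank_cycle_neutral w : (forall x y, w x y * w y x = 1) -> ~~ odd (size s) ->
  cgain w s = (-1) ^+ (size s)./2 ->
  \rank (wadj w (delv e (next s x0))) = \rank (wadj w e).
Proof.
move=> wK ep g.
have wK' x y : wtr w x y * wtr w y x = 1 by apply: wK.
have [u [u0 un uj ux]] := alternating_vector wK ep.
have [u' [u0' un' uj' ux']] := alternating_vector wK' ep.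
have g' : cgain (wtr w) s = (-1) ^+ p./2 by apply/eqP; rewrite sign_cgain_wtr // g.
apply: (@rank_delv_neutral _ _ _ _ _ u u') => //; first exact: simple_sym.
  move=> j; have [->|/uj//] := eqVneq j x0.
  by rewrite ux g -expr2 sqrr_sign subrr.
move=> j; have [->|/uj'//] := eqVneq j x0.
by rewrite ux' g' -expr2 sqrr_sign subrr.
Qed.

(* For odd [p] the value [u x0 = 0] propagates in steps of two in both directions
   around the cycle and reaches both neighbours of [x0]. *)
Lemma rank_cycle_odd w : (forall x y, w x y * w y x = 1) -> odd (size s) ->
  \rank (wadj w e) <> (\rank (wadj w (delv e x0))).+2.
Proof.
move=> wK op /rank_delv_drop2_witness[u [u0 uj]] /eqP ux; apply: ux.
have w0 x y : w x y != 0.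
  by apply: contra_eqN (wK x y) => /eqP ->; rewrite mul0r eq_sym oner_eq0.
have fl k : (k.+1 < p)%N -> (u (f k) == 0) = (u (f k.+2) == 0).
  move=> kp; have : flow w e u (f k.+1) = 0.
    by apply: uj; apply/negP => /eqP; rewrite -[x0]/(f 0) => /f_inj; lia.
  rewrite flow_f => /eqP; rewrite addr_eq0 => /eqP E; apply/idP/idP => /eqP h.
    by move/eqP: E; rewrite h mul0r eq_sym oppr_eq0 mulf_eq0 (negbTE (w0 _ _)) orbF.
  by move/eqP: E; rewrite h mul0r oppr0 mulf_eq0 (negbTE (w0 _ _)) orbF.
have up m : (m.*2 < p.+1)%N -> u (f m.*2) = 0.
  elim: m => [//|m IH] mp; apply/eqP; rewrite doubleS -fl; last by lia.
  by rewrite IH //; lia.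
have dn m : (m.*2 < p)%N -> u (f (p - m.*2)) = 0.
  elim: m => [|m IH] mp; first by rewrite subn0 fp.
  apply/eqP; rewrite fl; last by lia.
  by rewrite (_ : (_ - _).+2 = p - m.*2)%N ?IH //; lia.
have [q pq] : exists q, p = q.*2.+1 by exists p./2; have := odd_double_half p; rewrite op; lia.
have fq : f q.*2.+1 = x0 by rewrite -pq fp.
rewrite -fq flow_f -[f q.*2.+2]/(next s (f q.*2.+1)) fq -[next s x0]/(f 1).
have -> : u (f q.*2) = 0 by apply: up; rewrite pq; lia.
have := dn q; rewrite pq subSnn => -> //.
by rewrite !mul0r addr0.
Qed.

End CycleComponent.

(** * Graphs attaining the upper bound *)

Section Optimal.
Variables (F : fieldType) (K : numFieldType) (n : nat).
Variable w : 'I_n -> 'I_n -> F.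
Hypothesis wK : forall x y, w x y * w y x = 1.
Implicit Types (e f : rel 'I_n) (x y u v : 'I_n) (s t : seq 'I_n).

Definition gain_rank e := \rank (wadj w e).
(** A separate field [K], because the 0-1 matrix is real while the gains are complex. *)
Definition graph_rank e := \rank (wadj (fun _ _ => 1 : K) e).
Definition optimal e := gain_rank e = (graph_rank e + 2 * theta e)%N.

Lemma w_neq0 x y : w x y != 0.
Proof. by apply: contra_eqN (wK x y) => /eqP ->; rewrite mul0r eq_sym oner_eq0. Qed.

Lemma nedges_delv e x y : simple_graph e -> e x y -> (nedges (delv e x) < nedges e)%N.
Proof.
move=> se exy; apply: (nedges_lt se (@sub_delv _ e x) exy);
  by rewrite /delv eqxx ?andbF.
Qed.

Lemma nedges_pendant e x y : simple_graph e -> e x y ->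
  (nedges (delv (delv e x) y) < nedges e)%N.
Proof.
move=> se exy; apply: leq_ltn_trans (nedges_delv se exy).
by apply: nedges_sub; apply: sub_delv.
Qed.

Lemma pendant_or_no_dead_end e :
  (exists x y, pendant e x y) \/ (forall B, no_dead_end e B).
Proof.
have [/existsP[x /existsP[y /andP[exy /forallP H]]]|N] :=
  boolP [exists x, exists y, e x y && [forall z, e x z ==> (z == y)]].
  by left; exists x, y; split=> // z exz; apply/eqP/(implyP (H z)).
right=> B v y _ evy; move: N; rewrite negb_exists => /forallP/(_ v).
rewrite negb_exists => /forallP/(_ y); rewrite evy negb_forall => /existsP[z].
by rewrite negb_imply => /andP[evz zy]; exists z.
Qed.

Lemma gain_rank_pendant e x y : simple_graph e -> pendant e x y ->
  gain_rank e = (gain_rank (delv (delv e x) y)).+2.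
Proof. by move=> se; apply: rank_pendant => // i j; apply: w_neq0. Qed.

Lemma graph_rank_pendant e x y : simple_graph e -> pendant e x y ->
  graph_rank e = (graph_rank (delv (delv e x) y)).+2.
Proof. by move=> se; apply: rank_pendant => // i j; apply: oner_neq0. Qed.

Lemma simple_delv2 e x y : simple_graph e -> simple_graph (delv (delv e x) y).
Proof. by move=> se; do 2!apply: simple_delv. Qed.

Lemma sub_delv2 e x y : subrel (delv (delv e x) y) e.
Proof. by move=> a b /sub_delv/sub_delv. Qed.

(** Removing a pendant vertex with its neighbour lowers both ranks by 2; without pendant vertices,
    an edge would lead to a cycle. *)
Lemma rank_forest e : simple_graph e -> (forall x y, ~~ nonbridge e x y) ->
  gain_rank e = graph_rank e.
Proof.
move: {2}(nedges e) (leqnn (nedges e)) => k; elim: k e => [|k IH] e.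
  rewrite leqn0 => /eqP E0 se _.
  have ne x y : e x y = false.
    by apply/negP => exy; move: E0; rewrite (nedges_dele se exy).
  have H (F' : fieldType) (w' : 'I_n -> 'I_n -> F') : \rank (wadj w' e) = 0%N.
    suff -> : wadj w' e = 0 by rewrite mxrank0.
    by apply/matrixP=> i j; rewrite !mxE ne.
  by rewrite /gain_rank /graph_rank !H.
move=> ek se nb; have [E0|/(nedges_gt0 se)[a [b eab]]] := posnP (nedges e).
  by apply: IH; rewrite // E0.
have [[x [y px]]|nde] := pendant_or_no_dead_end e.
  rewrite (gain_rank_pendant se px) (graph_rank_pendant se px) IH //.
  - by case: px => exy _; rewrite -ltnS (leq_trans (nedges_pendant se exy)).
  - exact: simple_delv2.
  - by move=> c d; apply: contra (nb c d); apply/sub_nonbridge/sub_delv2.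
have ba : b \notin [set a].
  by rewrite inE; apply: contraTneq eab => ->; case: se => ei _; rewrite ei.
have [x [y [_ nxy]]] := no_dead_end_nonbridge se (nde set0) (sub0set _)
  (@connected_set1 _ e a) (set11 a) ba eab.
by case/negP: (nb x y).
Qed.

Lemma gain_rank_le e : simple_graph e -> (gain_rank e <= graph_rank e + 2 * theta e)%N.
Proof.
move: {2}(nedges e) (leqnn (nedges e)) => k; elim: k e => [|k IH] e ek se.
  rewrite (rank_forest se) ?leq_addr // => x y; apply/negP => /andP[exy _].
  by move: ek; rewrite (nedges_dele se exy).
have [/existsP[x /existsP[y nb]]|N] := boolP [exists x, exists y, nonbridge e x y].
  have ek' : (nedges (delv e x) <= k)%N.
    by case/andP: nb => exy _; rewrite -ltnS (leq_trans (nedges_delv se exy)).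
  have := IH _ ek' (simple_delv x se); have := theta_delv_nonbridge se nb.
  have := rank_delv_ge w e x; have := rank_delv_le (fun _ _ => 1 : K) e x.
  rewrite -/(gain_rank e) -/(graph_rank e) -/(gain_rank (delv e x)) -/(graph_rank (delv e x)); lia.
rewrite (rank_forest se) ?leq_addr // => x y; move: N; rewrite negb_exists.
by move/forallP/(_ x); rewrite negb_exists => /forallP/(_ y).
Qed.

(** Equality is forced at each estimate in the inductive step of [gain_rank_le]. *)
Lemma optimal_delv e x y : simple_graph e -> optimal e -> nonbridge e x y ->
  [/\ optimal (delv e x), theta e = (theta (delv e x)).+1,
      graph_rank (delv e x) = graph_rank e & gain_rank e = (gain_rank (delv e x)).+2].
Proof.
rewrite /optimal => se oe nb; have := gain_rank_le (simple_delv x se).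
have := theta_delv_nonbridge se nb.
have := rank_delv_ge w e x; have := rank_delv_le (fun _ _ => 1 : K) e x.
rewrite -/(gain_rank e) -/(graph_rank e) -/(gain_rank (delv e x)) -/(graph_rank (delv e x)) => *.
by split; lia.
Qed.

(** Both ranks drop by 2 and [theta] cannot grow; the upper bound for the smaller graph keeps it
    from shrinking. *)
Lemma optimal_pendant e x y : simple_graph e -> optimal e -> pendant e x y ->
  optimal (delv (delv e x) y) /\ theta (delv (delv e x) y) = theta e.
Proof.
rewrite /optimal => se oe px; have := gain_rank_le (simple_delv2 x y se).
have := gain_rank_pendant se px; have := graph_rank_pendant se px.
have := theta_delv x se; have := theta_delv y (simple_delv x se).
by split; lia.
Qed.

Lemma optimal_cyc_adj e s t x y : simple_graph e -> optimal e ->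
  is_cycle e s -> is_cycle e t -> x \in t -> cyc_adj s x y -> cyc_adj t x y.
Proof.
move=> se oe cs ct xt sxy; apply/negPn/negP => txy.
have := theta_delv_two_cycles se cs ct xt sxy txy.
by have [_ -> _ _] := optimal_delv se oe (is_cycle_nonbridge se cs sxy); rewrite ltnn.
Qed.

(** Walking along one cycle from the common vertex never leaves the other. Cycles are compared
    through [cyc_adj], as one cycle has many listings. *)
Lemma optimal_cycles_disjoint e s t x : simple_graph e -> optimal e ->
  is_cycle e s -> is_cycle e t -> x \in s -> x \in t -> cyc_adj s =2 cyc_adj t.
Proof.
move=> se oe; suff H s' t' : is_cycle e s' -> is_cycle e t' -> x \in s' -> x \in t' ->
    forall a b, cyc_adj s' a b -> cyc_adj t' a b.
  by move=> cs ct xs xt a b; apply/idP/idP; apply: H.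
move=> cs ct xs xt a b sab.
apply: (optimal_cyc_adj se oe cs ct) => //.
case/andP: (sab) => /andP[as_ _] _.
apply: (next_closed (P := mem t') cs xs) as_ => // c cs' ct'.
have := optimal_cyc_adj se oe cs ct ct' (cyc_adj_next cs').
by case/andP=> /andP[].
Qed.

Lemma pendant_bridge e x y z : simple_graph e -> pendant e x y -> ~~ nonbridge e x z.
Proof.
move=> se [exy H]; apply/negP => /andP[exz]; rewrite (H _ exz) => /connectP[[|a p] /=].
  by move=> _ yx; case: se => ei _; move: exy; rewrite yx ei.
by case/andP=> /and3P[/H->]; rewrite eqxx.
Qed.

(* Deleting the other cycles and all pendant trees isolates the cycle. *)
Lemma optimal_isolate_cycle e s : simple_graph e -> optimal e -> is_cycle e s ->
  exists f, [/\ simple_graph f, optimal f, is_cycle f s &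
    forall x y, x \in s -> f x y -> cyc_adj s x y].
Proof.
move: {2}(nedges e) (leqnn (nedges e)) => k; elim: k e => [|k IH] e ek se oe cs.
  exists e; split=> // x y _ exy; by move: ek; rewrite (nedges_dele se exy).
have [/existsP[c /andP[cs' /existsP[d nb]]]|N] :=
  boolP [exists c, (c \notin s) && [exists d, nonbridge e c d]].
  have [oc _ _ _] := optimal_delv se oe nb.
  apply: (IH (delv e c)) => //; last exact: is_cycle_delv.
    by case/andP: nb => ecd _; rewrite -ltnS (leq_trans (nedges_delv se ecd)).
  exact: simple_delv.
have [[x [y px]]|nde] := pendant_or_no_dead_end e.
  have [op th] := optimal_pendant se oe px; case: (px) => exy Hx.
  have xs : x \notin s.
    apply/negP => xs; have := is_cycle_nonbridge se cs (cyc_adj_next xs).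
    exact/negP/(pendant_bridge _ se px).
  (* Otherwise deleting [y] after [x] would break the cycle [s] and lower [theta], against [th]. *)
  have ys : y \notin s.
    apply/negP => ys; have sx := simple_delv x se.
    have := is_cycle_nonbridge sx (is_cycle_delv cs xs) (cyc_adj_next ys).
    by move/(theta_delv_nonbridge sx); have := theta_delv x se; lia.
  have ek' : (nedges (delv (delv e x) y) <= k)%N.
    by rewrite -ltnS (leq_trans (nedges_pendant se exy)).
  exact: (IH _ ek' (simple_delv2 x y se) op (is_cycle_delv (is_cycle_delv cs xs) ys)).
(* Here all cycle vertices lie on [s] and nothing is pendant. A chord would lie on a second cycle,
   and an edge leaving [s] would lead to a cycle vertex off [s]. *)
exists e; split=> // x y xs exy; have [ys|ys] := boolP (y \in s).
  apply/negPn/negP => sxy; have /and3P[_ _ cd] := is_cycle_dele cs sxy.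
  have nb : nonbridge e x y by rewrite /nonbridge exy (connect_cycle cd).
  have [t ct txy] := nonbridge_cycle se nb.
  by case/negP: sxy; apply: (optimal_cyc_adj se oe ct cs).
pose B := [set z in s].
have cB : connected_set e B.
  move=> a b; rewrite !inE => as_ bs; apply: (@connect_cycle _ _ s) => //.
  case/and3P: (cs) => us _ cys; apply: cycle_from_next => // c cS.
  by rewrite /restr next_cycle // !inE mem_next cS.
have xB : x \in B by rewrite inE.
have yB : y \notin B by rewrite inE.
have [a [b [aB nb]]] := no_dead_end_nonbridge se (nde B) (subxx _) cB xB yB exy.
case/negP: N; apply/existsP; exists a; rewrite inE in aB; rewrite aB.
by apply/existsP; exists b.
Qed.

Lemma cgain1 s : cgain (fun _ _ => 1 : K) s = 1.
Proof. by rewrite /cgain big1. Qed.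

(** On the isolated cycle, odd length or gain [(-1) ^+ (size s)./2] would prevent the drop of the
    gain rank by 2. For constant weight 1 the gain is 1, so odd [(size s)./2] would make the graph
    rank drop. *)
Lemma optimal_cycle_type e s : simple_graph e -> optimal e -> is_cycle e s ->
  [/\ ~~ odd (size s), cgain w s <> (-1) ^+ (size s)./2 & (size s %% 4 = 0)%N].
Proof.
move=> se0 oe0 cs0; have [f [sf of_ cs cl]] := optimal_isolate_cycle se0 oe0 cs0.
have [x xs] : exists x, x \in s.
  by case/and3P: cs; case: (s) => // a t; exists a; rewrite inE eqxx.
have D x' : x' \in s -> graph_rank (delv f x') = graph_rank f /\
    gain_rank f = (gain_rank (delv f x')).+2.
  move=> xs'; have := is_cycle_nonbridge sf cs (cyc_adj_next xs').
  by case/(optimal_delv sf of_).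
have os : ~~ odd (size s).
  apply/negP => os; have [_ ] := D x xs.
  exact: (rank_cycle_odd sf cs xs cl wK os).
have xn : next s x \in s by rewrite mem_next.
split=> //.
  move/(rank_cycle_neutral sf cs xs cl wK os) => E; have [_] := D _ xn.
  by rewrite /gain_rank E; lia.
have K1 (a b : 'I_n) : (1 : K) * 1 = 1 by rewrite mulr1.
have : ~~ odd (size s)./2.
  apply/negP => os2; have [+ _] := D x xs.
  have := rank_cycle_drop2 sf cs xs cl K1 os.
  rewrite cgain1 -signr_odd os2 expr1 => /(_ _)/wrap[|E]; last by rewrite /graph_rank E; lia.
  by rewrite -subr_eq0 opprK -mulr2n pnatr_eq0.
by have := odd_double_half (size s); lia.
Qed.

(** One vertex is deleted per cycle: this lowers [theta] by 1 and destroys only that cycle, by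
    disjointness. *)
Lemma optimal_cycle_list e : simple_graph e -> optimal e ->
  exists cs : seq (seq 'I_n),
    [/\ size cs = theta e, forall c, c \in cs -> is_cycle e c,
        forall i j, (i < size cs)%N -> (j < size cs)%N -> i <> j ->
          forall x, x \in nth [::] cs i -> x \notin nth [::] cs j &
        forall x y, nonbridge e x y -> has (fun c => cyc_adj c x y) cs].
Proof.
move: {2}(nedges e) (leqnn (nedges e)) => k; elim: k e => [|k IH] e ek se oe.
  have nb x y : nonbridge e x y = false.
    by apply/negP => /andP[exy _]; move: ek; rewrite (nedges_dele se exy).
  exists [::]; split=> // [|x y]; last by rewrite nb.
  have := rank_forest se (fun x y => negbT (nb x y)); move: oe; rewrite /optimal /=; lia.
have [/existsP[x /existsP[y nb]]|N] := boolP [exists x, exists y, nonbridge e x y]; last first.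
  have nb x y : nonbridge e x y = false.
    apply/negbTE; move: N; rewrite negb_exists => /forallP/(_ x).
    by rewrite negb_exists => /forallP/(_ y).
  exists [::]; split=> // [|x y]; last by rewrite nb.
  have := rank_forest se (fun x y => negbT (nb x y)); move: oe; rewrite /optimal /=; lia.
have [od th _ _] := optimal_delv se oe nb.
have [s cs sxy] := nonbridge_cycle se nb.
have xs : x \in s by case/andP: sxy => /andP[].
have ek' : (nedges (delv e x) <= k)%N.
  by case/andP: nb => exy _; rewrite -ltnS (leq_trans (nedges_delv se exy)).
have sd := simple_delv x se.
have [cl [szc cyc dis cov]] := IH _ ek' sd od.
have ds t a : t \in cl -> a \in s -> a \notin t.
  move=> /cyc ct as_; apply/negP => at_.
  have E := optimal_cycles_disjoint se oe cs (is_cycle_sub (@sub_delv _ _ x) ct) as_ at_.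
  move: (is_cycle_delv_notin ct); move: sxy; rewrite E.
  by case/andP=> /andP[->].
exists (s :: cl); split.
- by rewrite /= szc th.
- move=> c; rewrite inE => /orP[/eqP->//|/cyc]; exact/is_cycle_sub/sub_delv.
- move=> [|i] [|j] //= ip jp ij a.
  + by apply: ds; apply: mem_nth.
  + by apply: contraTN => as_; apply: ds as_; apply: mem_nth.
  + by apply: dis => //; congruence.
- move=> a b nab; have [t ct tab] := nonbridge_cycle se nab.
  have [xt|xt] := boolP (x \in t).
    by rewrite /= (optimal_cycles_disjoint se oe cs ct xs xt) tab.
  rewrite /= cov ?orbT //.
  by apply: is_cycle_nonbridge tab => //; apply: is_cycle_delv.
Qed.

(** Otherwise no edge joins a cycle vertex to one on no cycle. The latter would then span a graph
    without dead ends that has the edge [ab], hence contains a cycle. *)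
Lemma bridge_at_cycle e a b : simple_graph e -> (forall B, no_dead_end e B) ->
  e a b -> ~~ nonbridge e a b ->
  exists x y x', [/\ e x y, ~~ nonbridge e x y & nonbridge e x x'].
Proof.
move=> se nde eab nab; pose cyc v := [exists d, nonbridge e v d].
have [/existsP[x /existsP[y /and3P[cx exy nxy]]]|H0] :=
  boolP [exists x, exists y, [&& cyc x, e x y & ~~ nonbridge e x y]].
  by case/existsP: cx => d xd; exists x, y, d.
have H x y : cyc x -> e x y -> nonbridge e x y.
  move=> cx exy; move: H0; rewrite negb_exists => /forallP/(_ x).
  by rewrite negb_exists => /forallP/(_ y); rewrite cx exy negbK.
pose N := [set v | ~~ cyc v].
have aN : a \in N by rewrite inE; apply: contra nab => ca; apply: H.
have bN : b \in N.
  rewrite inE; apply: contra nab => cb; apply: nonbridge_sym => //; apply: H => //.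
  by rewrite (simple_sym se).
have sR : simple_graph (restr e N) by apply: simple_restr.
have nR : no_dead_end (restr e N) set0.
  move=> v z _ /and3P[evz vN zN]; have [||z' evz' zz'] := nde set0 v z; rewrite ?inE //.
  exists z' => //; rewrite /restr evz' vN inE; apply: contraTN vN => cz'.
  rewrite inE negbK; apply/existsP; exists z'; apply: nonbridge_sym => //.
  by apply: H => //; rewrite (simple_sym se).
have ba : b \notin [set a].
  by rewrite inE; apply: contraTneq eab => ->; case: se => ei _; rewrite ei.
have Rab : restr e N a b by rewrite /restr eab aN.
have [p [q [_ npq]]] := no_dead_end_nonbridge sR nR (sub0set _)
  (@connected_set1 _ _ a) (set11 a) ba Rab.
have : p \in N by case/andP: npq => /and3P[].
rewrite inE => /negP[]; apply/existsP; exists q.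
exact: sub_nonbridge (@sub_restr _ _ _) npq.
Qed.

(* A null vector supported on the colour class of [x], restricted to the side of
   the bridge that contains [x], is null away from [y]. *)
Lemma graph_rank_bridge e (col : 'I_n -> bool) x y : simple_graph e ->
  (forall a b, e a b -> col a != col b) -> e x y -> ~~ nonbridge e x y ->
  graph_rank (delv e x) = graph_rank e -> graph_rank e = (graph_rank (delv e y)).+2.
Proof.
move=> se hcol exy nxy /rank_delv_neutral_null[z z0 zx].
pose H v := connect (dele e x y) x v.
have Hy : ~~ H y by move: nxy; rewrite /nonbridge exy.
pose z1 v := if H v && (col v == col x) then z v else 0.
have z1y : z1 y = 0 by rewrite /z1 (negbTE Hy).
have es := simple_sym se.
have dsym i j : dele e x y i j = dele e x y j i by have [_ ->] := simple_dele x y se.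
have fj j : j != y -> flow (fun _ _ => 1) e z1 j = 0.
  move=> jy; have [cj|cj] := eqVneq (col j) (col x).
    rewrite /flow big1 // => i /hcol; rewrite cj => ci.
    by rewrite /z1 (negbTE ci) andbF mul0r.
  have jx : j != x by apply: contraNneq cj => ->.
  have ed i : e i j -> dele e x y i j.
    by move=> eij; rewrite /dele eij !xpair_eqE (negbTE jx) (negbTE jy) !andbF.
  have ci i : e i j -> col i == col x.
    by move/hcol; move: cj; case: (col i); case: (col j); case: (col x).
  have HE i : e i j -> H i = H j.
    move=> /ed dij; apply/idP/idP => h; apply: connect_trans h _; apply: connect1 => //.
    by rewrite dsym.
  have [Hj|Hj] := boolP (H j).
    rewrite -[RHS](z0 j); apply: eq_bigr => i eij.
    by rewrite /z1 HE // Hj ci.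
  by rewrite /flow big1 // => i eij; rewrite /z1 HE // (negbTE Hj) mul0r.
(* Only [x] contributes at [y]: any other neighbour of [y] on the side of [x] would connect the two
   sides without the bridge. *)
have fy : flow (fun _ _ => 1) e z1 y != 0.
  rewrite /flow (bigD1 x) //= big1 => [|i /andP[eiy ix]]; last first.
    rewrite /z1; case: ifP => [/andP[Hi _]|]; last by rewrite mul0r.
    case/negP: Hy; apply: connect_trans Hi _; apply: connect1.
    rewrite /dele eiy !xpair_eqE (negbTE ix) /=.
    by apply: contraTN exy => /andP[_ /eqP->]; case: se => ei _; rewrite ei.
  by rewrite /z1 /H connect0 eqxx mulr1 addr0.
exact: (rank_delv_drop2 (u := z1) (u' := z1) es z1y fj fy z1y fj fy).
Qed.

Lemma sum_neq0 (I : finType) (P : pred I) (g : I -> F) :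
  \sum_(i | P i) g i != 0 -> exists2 i, P i & g i != 0.
Proof.
move=> sn; have [/existsP[i /andP[Pi gi]]|N] := boolP [exists i, P i && (g i != 0)].
  by exists i.
case/eqP: sn; apply: big1 => i Pi; move: N; rewrite negb_exists => /forallP/(_ i).
by rewrite Pi /= negbK => /eqP.
Qed.

Lemma optimal_no_pendant e a b : simple_graph e -> optimal e ->
  (forall x y, ~ pendant e x y) -> e a b -> nonbridge e a b.
Proof.
move=> se oe np eab; apply/negPn/negP => nab.
have es := simple_sym se.
have [[x [y px]]|nde] := pendant_or_no_dead_end e; first exact: (np x y).
have [col hcol] := two_colouring se (fun t ct =>
  let: And3 h _ _ := optimal_cycle_type se oe ct in h).
have [x [y [x' [exy nxy cx]]]] := bridge_at_cycle se nde eab nab.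
have [_ _ r0x _] := optimal_delv se oe cx.
have r0y := graph_rank_bridge se hcol exy nxy r0x.
have sd := simple_delv y se.
have [od r1y] : optimal (delv e y) /\ gain_rank e = (gain_rank (delv e y)).+2.
  have := gain_rank_le sd; have := theta_delv y se; have := rank_delv_ge w e y.
  move: oe r0y; rewrite /optimal -/(gain_rank e) -/(gain_rank (delv e y)) => *.
  by split; lia.
have ny d : ~~ nonbridge e y d.
  apply/negP => /(optimal_delv se oe)[_ _ E _].
  by move: r0y; rewrite E; lia.
have [u [uy uj fy]] := rank_delv_drop2_witness r1y.
(* All neighbours of [y] have the other colour, so restricting to that class keeps the flow at
   vertices coloured like [y] and cancels it at the rest. *)
pose u1 v := if col v != col y then u v else 0.
have u1y : u1 y = 0 by rewrite /u1 eqxx.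
have fE j : col j = col y -> flow w e u1 j = flow w e u j.
  move=> cj; apply: eq_bigr => i /hcol; rewrite cj /u1 => ->//.
have f1y : flow w e u1 y != 0 by rewrite fE.
have f1j j : j != y -> flow w e u1 j = 0.
  move=> jy; have [cj|cj] := eqVneq (col j) (col y); first by rewrite fE // uj.
  rewrite /flow big1 // => i /hcol ci; rewrite /u1.
  have -> : col i = col y by move: ci cj; case: (col i); case: (col j); case: (col y).
  by rewrite eqxx mul0r.
have [v evy] := sum_neq0 f1y; rewrite mulf_eq0 negb_or => /andP[u1v _].
pose e' : rel 'I_n := fun c d => e c d && ((u1 c != 0) || (u1 d != 0)).
have e'e : subrel e' e by move=> c d /andP[].
have se' : simple_graph e'.
  case: (se) => ei _; split=> [c|c d]; rewrite /e' ?ei // es orbC //.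
(* A vertex in the support keeps all its edges. One off the support, other than [y], has flow zero,
   so a single neighbour in the support is impossible. *)
have nde' : no_dead_end e' [set y].
  move=> c d; rewrite inE => cy /andP[ecd ucd].
  have [uc|uc] := eqVneq (u1 c) 0; last first.
    have [|d' ecd' dd'] := nde set0 c d _ ecd; first by rewrite inE.
    by exists d' => //; rewrite /e' ecd' uc.
  rewrite uc eqxx /= in ucd.
  have := f1j c cy; rewrite /flow (bigD1 d) /=; last by rewrite es.
  move/eqP; rewrite addrC addr_eq0 => /eqP E.
  have [|d' /andP[ed'c dd']] := @sum_neq0 _ (fun i => e i c && (i != d)) (fun i => u1 i * w i c).
    by rewrite E oppr_eq0 mulf_neq0 // w_neq0.
  rewrite mulf_eq0 negb_or => /andP[ud' _].
  by exists d' => //; rewrite /e' es ed'c ud' orbT.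
have yv : e' y v by rewrite /e' es evy u1v orbT.
have vy : v \notin [set y] by rewrite inE; apply: contraNneq u1v => ->; rewrite u1y.
have [p [q [_ npq]]] := no_dead_end_nonbridge se' nde' (subxx _)
  (@connected_set1 _ _ y) (set11 y) vy yv.
(* Each edge of [e'] has an end in the support; the nonbridge edge is oriented to start there. *)
have [c [d [uc ncd]]] : exists c d, u1 c != 0 /\ nonbridge e c d.
  have nb := sub_nonbridge e'e npq.
  case/andP: npq => /andP[_ /orP[up|uq]] _; first by exists p, q.
  by exists q, p; split=> //; apply: nonbridge_sym.
have [s cs scd] := nonbridge_cycle se ncd.
have ys : y \notin s.
  apply/negP => ys; have := is_cycle_nonbridge se cs (cyc_adj_next ys).
  by apply/negP/ny.
have := is_cycle_nonbridge sd (is_cycle_delv cs ys) scd.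
move/(optimal_delv sd od)=> [_ _ _ r1c].
(* [u1] is a null vector of the graph without [y], in which [c] still lies on a cycle, so it must
   vanish at [c]. *)
case/eqP: uc; apply: (rank_delv_drop2_null r1c) => j.
have [->|jy] := eqVneq j y; last by rewrite flow_delv ?f1j.
by rewrite /flow big1 // => i; rewrite /delv eqxx !andbF.
Qed.

(** * Delta-transformations as vertex deletions *)

Lemma restr_delta e (S : {set 'I_n}) x y :
  restr e (S :\ x :\ y) = delv (delv (restr e S) x) y.
Proof.
apply: rel_ext => a b; rewrite /restr /delv !inE.
case: (e a b) => //=; case: (a \in S); case: (b \in S); rewrite ?andbF ?andbT //=.
by case: (a == x); case: (a == y); case: (b == x); case: (b == y).
Qed.

Lemma deg_in_pendant e (S : {set 'I_n}) x y : x \in S -> y \in S -> e x y ->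
  deg_in e S x = 1%N -> pendant (restr e S) x y.
Proof.
move=> xS yS exy /eqP/cards1P[z zE].
have zP c : c \in S -> e x c -> c = z.
  by move=> cS exc; apply/set1P; rewrite -zE inE cS.
split; first by rewrite /restr exy xS.
by move=> c /and3P[exc _ cS]; rewrite (zP c) // (zP y).
Qed.

Lemma pendant_deg_in e (S : {set 'I_n}) x y : pendant (restr e S) x y ->
  [/\ x \in S, y \in S, e x y & deg_in e S x = 1%N].
Proof.
move=> [/and3P[exy xS yS] H]; split=> //; apply/eqP/cards1P; exists y.
apply/setP=> c; rewrite !inE; apply/andP/eqP => [[cS exc]|->//].
by apply: H; rewrite /restr exc xS.
Qed.

Lemma delta_step_pendant e (S S' : {set 'I_n}) : delta_step e S S' ->
  exists x y, pendant (restr e S) x y /\ restr e S' = delv (delv (restr e S) x) y.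
Proof.
case=> x [y [xS yS exy dx ->]]; exists x, y; split; last exact: restr_delta.
exact: deg_in_pendant.
Qed.

Lemma optimal_delta_reach e (S : {set 'I_n}) : simple_graph e -> optimal (restr e S) ->
  exists S0, [/\ delta_star e S S0, no_pendant e S0, optimal (restr e S0),
    theta (restr e S0) = theta (restr e S) &
    forall x y, ~ pendant (restr e S0) x y].
Proof.
move=> se; move: {2}#|S| (leqnn #|S|) => k; elim: k S => [|k IH] S Sk oS.
  move: Sk; rewrite leqn0 cards_eq0 => /eqP S0; subst S.
  exists set0; split=> //; first exact: delta_refl.
    by move=> x; rewrite inE.
  by move=> x y [/and3P[_]]; rewrite inE.
have [[x [y px]]|np] := pselect (exists x y, pendant (restr e S) x y).
  have [xS yS exy dx] := pendant_deg_in px.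
  have [op th] := optimal_pendant (simple_restr S se) oS px.
  rewrite -restr_delta in op th.
  have Sk' : (#|S :\ x :\ y| <= k)%N.
    have : (#|S :\ x| <= k)%N by move: Sk; rewrite (cardsD1 x S) xS.
    by apply: leq_trans; apply/subset_leq_card/subsetDl.
  have [S0 [d1 d2 d3 d4 d5]] := IH _ Sk' op.
  exists S0; split; [|exact: d2|exact: d3|by rewrite d4|exact: d5].
  by apply: delta_next d1; exists x, y; exact: And5 xS yS exy dx (erefl _).
exists S; split=> //; first exact: delta_refl.
  move=> x xS dx; case: np; move/eqP/cards1P: (dx) => [y yE].
  have : y \in [set y] by rewrite inE.
  rewrite -yE inE => /andP[yS exy]; exists x, y; exact: deg_in_pendant.
by move=> x y px; case: np; exists x, y.
Qed.

(** The difference of the two ranks is invariant, written additively to avoid natural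
    subtraction. *)
Lemma delta_star_rank e (S S0 : {set 'I_n}) : simple_graph e -> delta_star e S S0 ->
  (gain_rank (restr e S) + graph_rank (restr e S0) =
   graph_rank (restr e S) + gain_rank (restr e S0))%N.
Proof.
move=> se; elim=> {S S0} [S|S S' S0 /delta_step_pendant[x [y [px E]]] _ IH].
  by rewrite addnC.
have sS := simple_restr S se.
by move: IH; rewrite (gain_rank_pendant sS px) (graph_rank_pendant sS px) E; lia.
Qed.

(** Deleting one vertex per cycle lowers the gain rank by 2 by Type B and keeps the graph rank by
    divisibility by 4; a forest remains, where the ranks agree. *)
Lemma rank_cycle_union e (cs : seq (seq 'I_n)) : simple_graph e ->
  (forall s t x, is_cycle e s -> is_cycle e t -> x \in s -> x \in t ->
     cyc_adj s =2 cyc_adj t) ->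
  (forall c, c \in cs -> [/\ is_cycle e c, ~~ odd (size c), (size c %% 4 = 0)%N,
     cgain w c <> (-1) ^+ (size c)./2 &
     forall x y, x \in c -> e x y -> cyc_adj c x y]) ->
  (forall i j, (i < size cs)%N -> (j < size cs)%N -> i <> j ->
     forall x, x \in nth [::] cs i -> x \notin nth [::] cs j) ->
  (forall x y, nonbridge e x y -> has (fun c => cyc_adj c x y) cs) ->
  gain_rank e = (graph_rank e + 2 * size cs)%N.
Proof.
elim: cs e => [|c cs IH] e se dis cyc nthd cov.
  by rewrite muln0 addn0; apply: rank_forest => // x y; apply/negP => /cov.
have [cc oc c4 gc cl] := cyc c (mem_head _ _).
have [v vc] : exists v, v \in c.
  by case/and3P: cc; case: (c) => // a t; exists a; rewrite inE eqxx.
have sd := simple_delv v se; have sv := @sub_delv _ e v.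
have vcs c' : c' \in cs -> v \notin c'.
  move=> c's; have := nthd 0%N (index c' cs).+1 isT; rewrite /= ltnS index_mem c's.
  by move=> /(_ isT); rewrite nth_index //; apply.
have -> : gain_rank e = (gain_rank (delv e v)).+2.
  by apply: (rank_cycle_drop2 se cc vc cl wK oc); apply/eqP.
have -> : graph_rank e = graph_rank (delv e v).
  have uc : uniq c by case/and3P: cc.
  have K1 (a b : 'I_n) : (1 : K) * 1 = 1 by rewrite mulr1.
  (* [rank_cycle_neutral] deletes the successor of its base point, so the base point is the
     predecessor of [v]. *)
  have pvc : prev c v \in c by rewrite mem_prev.
  have := rank_cycle_neutral se cc pvc cl K1 oc; rewrite next_prev // cgain1 => E.
  apply/esym/E; rewrite -signr_odd (_ : odd _ = false) //.
  by move: (size c) c4 oc => m c4 om; clear -c4 om; lia.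
rewrite (IH (delv e v)) //=; first by lia.
- by move=> s t x cs' ct; apply: dis; apply: is_cycle_sub; eassumption.
- move=> c' c's; have [c1 c2 c3 c5 c6] := cyc c' (mem_behead (s := c :: cs) c's).
  by split=> //; [apply: is_cycle_delv => //; apply: vcs | move=> x y xc /sv; apply: c6].
- by move=> i j ip jp ij; apply: (nthd i.+1 j.+1) => //; congruence.
- move=> x y nxy; have := cov x y (sub_nonbridge sv nxy) => /= /orP[cxy|//].
  have [t ct txy] := nonbridge_cycle sd nxy.
  have xc : x \in c by case/andP: cxy => /andP[].
  have xt : x \in t by case/andP: txy => /andP[].
  have := cyc_adj_next vc; rewrite (dis c t x cc (is_cycle_sub sv ct) xc xt).
  by case/andP=> /andP[vt _] _; move: (is_cycle_delv_notin ct); rewrite vt.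
Qed.

End Optimal.

(** * Unit gains as invertible weights, and the characterisation *)

Section UnitGain.
Variables (R : realType) (n : nat) (e : rel 'I_n) (phi : 'I_n -> 'I_n -> R[i]).
Hypotheses (se : simple_graph e) (ug : unit_gain e phi).

(* The value [1] off the edges makes the inverse law unconditional. *)
Definition full_gain (x y : 'I_n) : R[i] := if e x y then phi x y else 1.

Lemma full_gainK x y : full_gain x y * full_gain y x = 1.
Proof.
rewrite /full_gain (simple_sym se y x); case: ifP => [exy|_]; last by rewrite mulr1.
by have [n1 ->] := ug exy; rewrite -normCK n1 expr1n.
Qed.

Lemma gain_adjE : gain_adj e phi = wadj full_gain e.
Proof.
by apply/matrixP=> i j; rewrite !mxE /full_gain; case: ifP.
Qed.

Lemma cycle_gainE s : is_cycle e s -> cycle_gain phi s = cgain full_gain s.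
Proof.
move=> cs; rewrite /cycle_gain /cgain big_seq [RHS]big_seq; apply: eq_bigr => x xs.
by rewrite /full_gain (is_cycle_next cs xs).
Qed.

End UnitGain.

Lemma restrT n (e : rel 'I_n) : restr e setT = e.
Proof. by apply: rel_ext => a b; rewrite /restr !inE !andbT. Qed.

Theorem theorem4p9 (R : realType) (n : nat) (e : rel 'I_n)
  (phi : 'I_n -> 'I_n -> R[i]) :
  simple_graph e -> unit_gain e phi ->
  (\rank (gain_adj e phi) = \rank (adj01 R e) + 2 * theta e)%N
  <->
  [/\ (* (i) cycles pairwise vertex-disjoint *)
      (forall s t, is_cycle e s -> is_cycle e t ->
         (forall x y, cyc_adj s x y = cyc_adj t x y) \/
         (forall x, x \in s -> x \notin t)),
      (* (ii) every cycle is of Type B with order divisible by 4 *)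
      (forall s, is_cycle e s -> typeB phi s /\ (size s %% 4 = 0)%N) &
      (* (iii) delta-transformations reach a crucial subgraph G0 which is
         the disjoint union of theta(G) cycles and isolated vertices *)
      (exists S0 : {set 'I_n}, exists cs : seq (seq 'I_n),
         [/\ delta_star e [set: 'I_n] S0 /\ no_pendant e S0,
             size cs = theta e,
             (forall c, c \in cs -> is_cycle e c /\ {subset c <= S0}),
             (forall i j, (i < size cs)%N -> (j < size cs)%N -> i <> j ->
                forall x, x \in nth [::] cs i -> x \notin nth [::] cs j) &
             (forall x y, x \in S0 -> y \in S0 ->
                e x y = has (fun c => cyc_adj c x y) cs)])].
Proof.
move=> se ug; rewrite (gain_adjE e phi).
have wK := full_gainK se ug; set w := full_gain e phi in wK *.
rewrite -[\rank (adj01 R e)]/(graph_rank R e) -[\rank _]/(gain_rank w e); split=> [oe|].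
  have {}oe : optimal R w e by [].
  split.
  - move=> s t cs ct; have [/hasP[x xs xt]|] := boolP (has (mem t) s).
      by left; apply: (optimal_cycles_disjoint wK se oe cs ct xs xt).
    by move=> /hasPn H; right=> x /H.
  - move=> s cs; have [os gs s4] := optimal_cycle_type wK se oe cs.
    by split=> //; split=> //; rewrite (cycle_gainE phi cs).
  - have oT : optimal R w (restr e setT) by rewrite restrT.
    have [S0 [dS nS oS th np]] := optimal_delta_reach wK se oT.
    have sS := simple_restr S0 se.
    have [cs [szc cyc dis cov]] := optimal_cycle_list wK sS oS.
    exists S0, cs; split; [exact: conj dS nS| | |exact: dis|].
    + by rewrite restrT in th; move: th => <-; clear -szc; exact: szc.
    + move=> c /cyc cc; split; first exact: is_cycle_sub (@sub_restr _ _ _) cc.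
      by move=> x /(is_cycle_next cc)/and3P[].
    + move=> x y xS yS; apply/idP/idP => [exy|/hasP[c /cyc cc cxy]].
        apply: cov; apply: (optimal_no_pendant wK sS oS np).
        by rewrite /restr exy xS.
      by have /and3P[] := cyc_adj_edge sS cc cxy.
(* Conversely, [rank_cycle_union] gives the difference [2 * theta e] on [S0], and [delta_star_rank]
   carries it back to the whole graph. *)
case=> dis typ [S0 [cs [[dS _] szc cyc disc adj]]].
have sS := simple_restr S0 se; have sub := @sub_restr _ e S0.
have := delta_star_rank R wK se dS; rewrite restrT.
rewrite (@rank_cycle_union _ R _ w wK (restr e S0) cs sS) ?szc; first by lia.
- move=> s t x /(is_cycle_sub sub) c1 /(is_cycle_sub sub) c2 xs xt.
  by case: (dis s t c1 c2) => // /(_ _ xs); rewrite xt.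
- move=> c ccs; have [cc cS] := cyc c ccs; have [[oc gc] c4] := typ c cc.
  split=> //.
  + case/and3P: (cc) => uc sc cyc'; rewrite /is_cycle uc sc.
    apply: cycle_from_next => // x xc.
    by rewrite /restr (is_cycle_next cc xc) !cS // mem_next.
  + by rewrite -(cycle_gainE phi cc).
  (* The edge lies on a listed cycle, which meets [c] at [x] and therefore has the same
     adjacencies. *)
  + move=> x y xc /and3P[exy xS yS]; move: exy; rewrite adj //.
    case/hasP=> c' c's c'xy.
    have xc' : x \in c' by case/andP: c'xy => /andP[].
    have [c'c _] := cyc c' c's.
    case: (dis c c' cc c'c) => [->//|/(_ _ xc)]; by rewrite xc'.
- by rewrite -szc.
- by move=> x y /andP[/and3P[exy xS yS] _]; rewrite -adj.
Qed.
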